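(* Let $k\geq 3$ be an odd integer. Let $\mu=\sum_{\lambda\in\Lambda}a(\lambda)\delta_\lambda$ be a measure on $\mathbb{R}^k$ whose support $\Lambda$ is a locally finite set. Suppose that $\mu$ is a temperate distribution, and that its Fourier transform $\widehat{\mu}=\sum_{s\in S}b(s)\delta_s$ is also a measure, supported on a locally finite set $S\subset\mathbb{R}^k$. Assume that $0\notin\Lambda$ and $0\notin S$, and let $\sigma$ be the measure on $\mathbb{R}$ defined by $$\sigma=\sum_{\lambda\in\Lambda}\frac{a(\lambda)}{|\lambda|}\big(\delta_{|\lambda|}-\delta_{-|\lambda|}\big).$$ Then $\sigma$ is a temperate distribution whose one-dimensional Fourier transform is $$\widehat{\sigma}=-i\sum_{s\in S}\frac{b(s)}{|s|^{k-2}}\Big[\sum_{j=0}^{(k-3)/2}\beta_{j,k}\,|s|^j\Big((-1)^j\,\delta^{(j)}_{|s|}-\delta^{(j)}_{-|s|}\Big)\Big],$$ where $$\beta_{j,k}=\frac{(-1)^j\,(k-j-3)!}{j!\,(k-2j-3)!!}\Big(\frac{1}{2\pi}\Big)^{(k-3)/2}\quad (0\leq j\leq (k-3)/2).$$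
   Context: A set is locally finite if it has no finite accumulation points. The coefficients $a(\lambda),b(s)$ are complex, $|\cdot|$ is the Euclidean norm, and $\delta_x$ is the unit mass at $x$; $\delta_x^{(j)}$ is its $j$-th distributional derivative, $\langle\delta_x^{(j)},\varphi\rangle=(-1)^j\varphi^{(j)}(x)$. A temperate distribution is a distribution (continuous linear functional on the space of infinitely smooth compactly supported functions) that extends to a continuous linear functional on the Schwartz space. Infinite sums of distributions supported on a locally finite set are understood via their action on compactly supported smooth test functions. The Fourier transform of a Schwartz function on $\mathbb{R}^k$ is $\widehat{\varphi}(\xi)=\int_{\mathbb{R}^k}\varphi(x)e^{-2\pi i\langle\xi,x\rangle}\,dx$, and that of a temperate distribution is defined by $\langle\widehat{\sigma},\varphi\rangle=\langle\sigma,\widehat{\varphi}\rangle$ (bilinear pairing, no conjugation). The double factorial is $n!!=n(n-2)(n-4)\cdots$ (ending in $1$ or $2$), with $0!!=1$. *)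

(* Defs.v *)
From mathcomp Require Import all_boot all_order all_algebra.
From mathcomp Require Import all_classical all_reals all_analysis.
From mathcomp.real_closed Require Import complex.

Set Implicit Arguments.
Unset Strict Implicit.
Unset Printing Implicit Defensive.

Import Order.TTheory GRing.Theory Num.Theory.
Import numFieldNormedType.Exports.

Local Open Scope classical_set_scope.
Local Open Scope ring_scope.
Local Open Scope complex_scope.

Definition normC (R : realType) (z : R[i]) : R := ComplexField.Normc.normc z.

Definition expi (R : realType) (t : R) : R[i] := cos t +i* sin t.

(* n (n-2) (n-4) ..., ending in 1 or 2; equal to 1 for n = 0. *)
Fixpoint dfact (n : nat) : nat := if n is n'.+2 then (n * dfact n')%N else 1%N.

Definition locally_finite (T : topologicalType) (A : set T) : Prop :=
  limit_point A = set0.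

Section TestFunctions.
Context {R : realType} {V : normedModType R}.
Implicit Types (f : V -> R[i]) (u T : (V -> R[i]) -> R[i]).

(* Derivatives of complex-valued functions are taken on the real and imaginary
   parts. Iterated directional derivatives along arbitrary lists of vectors
   replace partial derivatives and multi-indices, so that the same definitions
   serve for V = R and V = R^k. *)
Definition cderive (v : V) f : V -> R[i] :=
  fun x => 'D_v (fun y => complex.Re (f y)) x
           +i* 'D_v (fun y => complex.Im (f y)) x.

Definition iter_cderive (vs : seq V) f : V -> R[i] := foldr cderive f vs.

Definition smooth f : Prop := forall vs : seq V,
  [/\ continuous (fun y => complex.Re (iter_cderive vs f y)),
      continuous (fun y => complex.Im (iter_cderive vs f y)) &
      forall x v, derivable (fun y => complex.Re (iter_cderive vs f y)) x v /\
                  derivable (fun y => complex.Im (iter_cderive vs f y)) x v].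

Definition test_fun f : Prop :=
  smooth f /\ compact (closure [set x | f x != 0]).

(* On V = 'rV[R]_k the norm `|x| is the sup norm. It is equivalent to the
   Euclidean one, hence gives the same Schwartz space with the same topology. *)
Definition schwartz f : Prop :=
  smooth f /\ forall (m : nat) (vs : seq V), exists M : R,
    forall x, `|x| ^+ m * normC (iter_cderive vs f x) <= M.

Definition seminorm (m : nat) (vs : seq V) f : R :=
  sup (range (fun x => `|x| ^+ m * normC (iter_cderive vs f x))).

(* Functionals are total; only their values on the relevant space of functions
   (test functions or Schwartz functions) are meaningful. *)
Definition linear_on (P : (V -> R[i]) -> Prop) T : Prop :=
  forall (c : R[i]) f g, P f -> P g ->
    T (fun x => c * f x + g x) = c * T f + T g.

Definition distribution u : Prop :=
  linear_on test_fun u /\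
  forall K : set V, compact K ->
    exists (C : R) (L : seq (seq V)), forall f, test_fun f ->
      (forall x, ~ K x -> f x = 0) ->
      normC (u f) <= C * \sum_(vs <- L) seminorm 0 vs f.

Definition schwartz_functional T : Prop :=
  linear_on schwartz T /\
  exists (C : R) (L : seq (nat * seq V)), forall f, schwartz f ->
    normC (T f) <= C * \sum_(p <- L) seminorm p.1 p.2 f.

Definition schwartz_extension u T : Prop :=
  schwartz_functional T /\ forall f, test_fun f -> T f = u f.

Definition temperate u : Prop :=
  distribution u /\ exists T, schwartz_extension u T.

(* v is the Fourier transform of u, for a Fourier transform F of functions. The
   transform of a test function need not have compact support, so it is the
   (unique) extension of u to the Schwartz space that is evaluated on it. *)
Definition has_fourier_wrt (F : (V -> R[i]) -> V -> R[i]) u v : Prop :=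
  exists T, schwartz_extension u T /\ forall f, test_fun f -> v f = T (F f).

Definition delta (x : V) : (V -> R[i]) -> R[i] := fun f => f x.

(* The measure \sum_(x in A) a(x) \delta_x. The sum in its value at a function f
   is a finite-support sum: when A is locally finite and f has compact support
   only finitely many terms are nonzero. *)
Definition discrete_measure (A : set V) (a : V -> R[i]) :
    (V -> R[i]) -> R[i] :=
  fun f => \sum_(x \in A) a x * delta x f.

End TestFunctions.

Section RealLine.
Context {R : realType}.

Definition integralR (f : R -> R) : R :=
  \int[@lebesgue_measure R]_(x in [set: R]) f x.

Definition fourier1 (f : R -> R[i]) : R -> R[i] := fun xi =>
  integralR (fun x => complex.Re (f x * expi (- (2 * pi * (xi * x)))))
  +i* integralR (fun x => complex.Im (f x * expi (- (2 * pi * (xi * x))))).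

Definition deriv_delta (j : nat) (x : R) : (R -> R[i]) -> R[i] := fun f =>
  (-1) ^+ j * (derive1n j (fun y => complex.Re (f y)) x
               +i* derive1n j (fun y => complex.Im (f y)) x).

End RealLine.

Section EuclideanSpace.
Context {R : realType}.

Definition dotv (k : nat) (x y : 'rV[R]_k) : R :=
  \sum_(i < k) x ord0 i * y ord0 i.

Definition enorm (k : nat) (x : 'rV[R]_k) : R := Num.sqrt (dotv x x).

(* Integral over R^k with respect to the k-fold product of Lebesgue measure, as
   an iterated Lebesgue integral. It is only used for Schwartz functions times
   characters, for which Fubini's theorem makes the two agree. *)
Fixpoint integralRk (k : nat) : ('rV[R]_k -> R) -> R :=
  if k is k'.+1 return ('rV[R]_k -> R) -> R then
    fun f => integralR (fun t : R =>
      integralRk (fun x : 'rV[R]_k' => f (row_mx (t%:M : 'rV[R]_1) x)))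
  else fun f => f 0.

Definition fourierk (k : nat) (f : 'rV[R]_k -> R[i]) : 'rV[R]_k -> R[i] :=
  fun xi =>
  integralRk (fun x => complex.Re (f x * expi (- (2 * pi * dotv xi x))))
  +i* integralRk (fun x => complex.Im (f x * expi (- (2 * pi * dotv xi x)))).

End EuclideanSpace.

Definition has_fourier1 (R : realType) (u v : (R -> R[i]) -> R[i]) : Prop :=
  has_fourier_wrt fourier1 u v.

Definition has_fourierk (R : realType) (k : nat)
    (u v : ('rV[R]_k -> R[i]) -> R[i]) : Prop :=
  has_fourier_wrt (@fourierk R k) u v.

Section RadialDistributions.
Context {R : realType} (k : nat).

Definition beta_coef (j : nat) : R :=
  (-1) ^+ j * ((k - j - 3)`!)%:R / ((j`!)%:R * (dfact (k - 2 * j - 3))%:R)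
  * (1 / (2 * pi)) ^+ ((k - 3) %/ 2).

Definition sigma_measure (Lambda : set 'rV[R]_k) (a : 'rV[R]_k -> R[i]) :
    (R -> R[i]) -> R[i] := fun f =>
  \sum_(l \in Lambda)
    a l / (enorm l)%:C * (delta (enorm l) f - delta (- enorm l) f).

Definition sigma_fourier (S : set 'rV[R]_k) (b : 'rV[R]_k -> R[i]) :
    (R -> R[i]) -> R[i] := fun f =>
  - 'i * \sum_(s \in S)
    b s / ((enorm s) ^+ (k - 2))%:C *
    \sum_(0 <= j < ((k - 3) %/ 2).+1)
      (beta_coef j * enorm s ^+ j)%:C *
      ((-1) ^+ j * deriv_delta j (enorm s) f - deriv_delta j (- enorm s) f).

End RadialDistributions.

(* Main.v *)
Require Import Defs.
From mathcomp Require Import all_boot all_order all_algebra.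
From mathcomp Require Import all_classical all_reals all_analysis.
From mathcomp.real_closed Require Import complex.
From mathcomp Require Import measurable_realfun.
From mathcomp Require Import zify ring lra.
Import Order.TTheory GRing.Theory Num.Theory.
Import numFieldNormedType.Exports.
Local Open Scope classical_set_scope.
Local Open Scope ring_scope.
Local Open Scope complex_scope.

(** Testing mu against radial functions turns the theorem into a statement about one
    variable. For a function f on the line let lift f be the function on R^k given
    by o (|x|) / |x| with o (r) = f (r) - f (- r). Then sigma f = mu (lift f) because Lambda misses
    the origin (sigma_lift), and lift maps Schwartz functions to Schwartz functions
    continuously (lift_schwartz, lift_tame), so T o lift extends sigma whenever T
    extends mu.

    The profile o (r) / r of lift f is even and smooth by Hadamard's integral formula (hadamard, quot). If E is even and
    smooth then so is D E = E' (r) / r, and the derivative of E (|x|) along v is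
    <x, v> (D E) (|x|); hence derivatives of radial functions are sums of products of
    linear forms with some (D^j E) (|x|), which gives smoothness and uniform Schwartz
    estimates together (rop, rop_derive, rop_bound).

    For the transform of sigma one needs, for each test function f, a test function
    h on R^k whose Fourier transform is lift (fourier1 f): then
      sigma^ (f) = T (lift (fourier1 f)) = T (fourierk h) = mu^ (h).
    Radial Fourier transforms walk between dimensions: if walk E = - D E / (2 pi),
    then the transform of walk E (|x|) on R^(k+2) and that of E (|x|) on R^k are the
    same function of |xi|. Iterating from the line to k = 2 m + 3, the transform of
    walk^(m+1) E (|x|) is the transform of E on the line evaluated at |xi|
    (integralRk_radial). If E' = - 2 pi o then walk E is the profile of f, and
    integration by parts shows that the line transform of E is, up to a factor i, the
    profile of the transform of f (profile_fourier). So
    h = - i walk^m (profile f) (|x|) (fourier_lift), and expanding walk^m of a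
    quotient gives the coefficients beta (iter_walk_quot, beta_coefE).

    The walk rests on the identity that integrating - D E / (2 pi) over a plane at
    distance s from the origin gives E (s) (integral_polar), and on the invariance of
    double integrals under rotations, obtained from shears (integral2_rotation).
    Radiality lets one rotate the frequency into a coordinate axis, three coordinates
    at a time, and then integrate out the other two (integral_three_to_one). *)

Set Implicit Arguments.
Unset Strict Implicit.
Unset Printing Implicit Defensive.

(* Inside integrals the formulas are read in ring_scope, where these two notations
   would otherwise denote derivatives of polynomials. *)
Local Notation "f ^` ()" := (derive1 f) : ring_scope.
Local Notation "f ^` ( n )" := (derive1n n f) : ring_scope.

(** * Derivatives and smooth functions of one variable *)

Section Derivation.
Context {R : realType} {V : normedModType R}.
Implicit Types (f g : V -> R) (x v : V).

Lemma is_derive_add f g x v a b : is_derive x v f a -> is_derive x v g b ->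
  is_derive x v (fun y => f y + g y) (a + b).
Proof. by move=> df dg; exact: is_deriveD. Qed.

Lemma is_derive_sub f g x v a b : is_derive x v f a -> is_derive x v g b ->
  is_derive x v (fun y => f y - g y) (a - b).
Proof. by move=> df dg; exact: is_deriveB. Qed.

Lemma is_derive_mul f g x v a b : is_derive x v f a -> is_derive x v g b ->
  is_derive x v (fun y => f y * g y) (a * g x + f x * b).
Proof.
move=> df dg; apply: (is_derive_eq (is_deriveM df dg)).
by rewrite /GRing.scale /= addrC mulrC.
Qed.

Lemma is_derive_const (c : R) x v : is_derive x v (fun=> c) 0.
Proof. exact: is_derive_cst. Qed.

Lemma is_derive_cmul (c : R) f x v a : is_derive x v f a ->
  is_derive x v (fun y => c * f y) (c * a).
Proof.
move=> df; apply: (is_derive_eq (is_derive_mul (is_derive_const c x v) df)).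
by rewrite mul0r add0r.
Qed.

End Derivation.

Section Continuity.
Context {R : realType} {T : topologicalType}.
Implicit Types (f g : T -> R).

Lemma cts_const (c : R) : continuous (fun _ : T => c).
Proof. exact: cst_continuous. Qed.

Lemma cts_add f g : continuous f -> continuous g ->
  continuous (fun x => f x + g x).
Proof. by move=> cf cg x; apply: cvgD; [exact: cf|exact: cg]. Qed.

Lemma cts_mul f g : continuous f -> continuous g ->
  continuous (fun x => f x * g x).
Proof. by move=> cf cg x; apply: cvgM; [exact: cf|exact: cg]. Qed.

Lemma cts_comp f (h : R -> R) : continuous f -> continuous h ->
  continuous (fun x => h (f x)).
Proof. by move=> cf ch x; apply: continuous_comp; [exact: cf|exact: ch]. Qed.

Lemma cts_norm f : continuous f -> continuous (fun x => `|f x|).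
Proof. by move=> cf x; apply: cvg_norm; exact: cf. Qed.

End Continuity.

Lemma cts_id {R : realType} : continuous (fun x : R => x).
Proof. by move=> x; exact: cvg_id. Qed.

Lemma cts_scale {R : realType} (c : R) : continuous (fun x : R => c * x).
Proof. by apply: cts_mul; [exact: cts_const|exact: cts_id]. Qed.

Section Smooth.
Context {R : realType}.
Implicit Types (f g : R -> R) (K : nat -> R -> R).
Local Notation mu := (@lebesgue_measure R).

Lemma is_derive_chain f g (x a b : R) : is_derive (g x) 1 f a ->
  is_derive x 1 g b -> is_derive x 1 (fun y => f (g y)) (a * b).
Proof. by move=> df dg; exact: is_derive1_comp. Qed.

Lemma is_derive_inv f (x a : R) : f x != 0 -> is_derive x 1 f a ->
  is_derive x 1 (fun y => (f y)^-1) (- a / f x ^+ 2).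
Proof.
move=> fx0 df; apply: (is_derive_eq (is_deriveV fx0 df)).
by rewrite /GRing.scale /= mulrC mulrN mulNr.
Qed.

Lemma is_derive_idR (x : R) : is_derive x 1 (fun y : R => y) 1.
Proof. exact: is_derive_id. Qed.

Lemma is_derive_opp (x : R) : is_derive x 1 (fun y : R => - y) (-1).
Proof. exact: is_deriveNid. Qed.

Lemma is_derive_scale (c x : R) : is_derive x 1 (fun y : R => c * y) c.
Proof.
by apply: (is_derive_eq (is_derive_cmul c (is_derive_idR x))); rewrite mulr1.
Qed.

Lemma is_derive_sq (x : R) : is_derive x 1 (fun y : R => y ^+ 2) (2 * x).
Proof.
have := is_derive_mul (is_derive_idR x) (is_derive_idR x).
have -> : (fun y : R => y * y) = (fun y => y ^+ 2).
  by apply/funext => y; rewrite expr2.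
by move=> h; apply: (is_derive_eq h); lra.
Qed.

Lemma is_derive_unique f (x a b : R) :
  is_derive x 1 f a -> is_derive x 1 f b -> a = b.
Proof. by move=> [_ <-] [_ <-]. Qed.

Lemma is_derive_derive1 f (x a : R) : is_derive x 1 f a -> f^`() x = a.
Proof. by move=> [_ <-]; rewrite derive1E. Qed.

Lemma derivable_is_derive f (x : R) :
  derivable f x 1 -> is_derive x 1 f (f^`() x).
Proof. by move=> df; split => //; rewrite derive1E. Qed.

Lemma is_derive_continuous f (x a : R) : is_derive x 1 f a ->
  {for x, continuous f}.
Proof.
by move=> [df _]; exact/differentiable_continuous/derivable1_diffP.
Qed.

Lemma is_derive_cvg f (x a : R) : is_derive x 1 f a ->
  h^-1 * (f (h + x) - f x) @[h --> 0^'] --> a.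
Proof.
case=> df <-; rewrite /derive.
have -> : (fun h => h^-1 * (f (h + x) - f x)) =
   (fun h : R => h^-1 *: ((f \o shift x) (h *: (1 : R)) - f x)).
  by apply/funext => h; rewrite /= /GRing.scale /= mulr1.
exact: df.
Qed.

Lemma cvg_is_derive f (x a : R) :
  h^-1 * (f (h + x) - f x) @[h --> 0^'] --> a -> is_derive x 1 f a.
Proof.
have -> : (fun h => h^-1 * (f (h + x) - f x)) =
   (fun h : R => h^-1 *: ((f \o shift x) (h *: (1 : R)) - f x)).
  by apply/funext => h; rewrite /= /GRing.scale /= mulr1.
move=> h; split; first by apply/cvg_ex; exists a.
exact: (cvg_lim _ h).
Qed.

Definition rsmooth f := forall n (x : R), derivable (f^`(n)) x 1.

(** The successive derivatives of a smooth function, given all at once.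
    Operators that preserve smoothness are built on whole towers, since the
    formula for the n-th derivative is known before differentiability is. *)
Definition tower K := forall n (x : R), is_derive x 1 (K n) (K n.+1 x).

Lemma rsmooth_tower f : rsmooth f -> tower (fun n => f^`(n)).
Proof. by move=> sf n x; exact: derivable_is_derive. Qed.

Lemma tower_derive1n K : tower K -> forall n, (K 0%N)^`(n) = K n.
Proof.
move=> tK; elim=> [//|n ih]; rewrite derive1nS ih; apply/funext => x.
exact: is_derive_derive1.
Qed.

Lemma tower_rsmooth K : tower K -> rsmooth (K 0%N).
Proof. by move=> tK n x; rewrite tower_derive1n //; case: (tK n x). Qed.

Lemma rsmooth_derive f : rsmooth f -> rsmooth (f^`()).
Proof. by move=> sf n x; rewrite -derive1Sn; exact: sf. Qed.

Lemma rsmooth_is_derive f (x : R) : rsmooth f -> is_derive x 1 f (f^`() x).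
Proof. by move=> sf; apply: derivable_is_derive; exact: (sf 0%N). Qed.

Lemma rsmooth_cts f : rsmooth f -> continuous f.
Proof. by move=> sf x; exact: is_derive_continuous (rsmooth_is_derive x sf). Qed.

Lemma rsmooth_ctsn n f : rsmooth f -> continuous (f^`(n)).
Proof.
by move=> sf x; exact: is_derive_continuous (rsmooth_tower sf n x).
Qed.

Lemma continuous_bounded_itv f (a b : R) : a <= b -> continuous f ->
  exists2 M : R, 0 <= M & forall x : R, a <= x <= b -> `|f x| <= M.
Proof.
move=> ab cf.
have cn : {within `[a, b], continuous (fun x => `|f x|)}.
  by apply: continuous_subspaceT; exact: cts_norm.
have [c _ hc] := EVT_max ab cn.
by exists `|f c| => // x hx; apply: hc; rewrite in_itv.
Qed.

Lemma itv_integrable f (a b : R) : continuous f ->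
  mu.-integrable `[a, b] (EFin \o f).
Proof.
move=> cf; apply: continuous_compact_integrable; first exact: segment_compact.
exact: continuous_subspaceT.
Qed.

(** The candidates for the derivatives of (o r) / r: by Hadamard's formula
    o r = r \int_0^1 o' (r s) ds when o 0 = 0, and differentiating j times under
    the integral sign brings down the weight s ^ j. *)
Definition hadamard f (j : nat) (r : R) : R :=
  \int[mu]_(s in `[0, 1]) (s ^+ j * f^`(j.+1) (r * s)).

Lemma hadamard_integrand_cts f j r : rsmooth f ->
  continuous (fun s : R => s ^+ j * f^`(j.+1) (r * s)).
Proof.
move=> sf; apply: cts_mul; first exact: exprn_continuous.
by apply: cts_comp; [exact: cts_scale|exact: rsmooth_ctsn].
Qed.

Lemma hadamard_tower f : rsmooth f -> tower (hadamard f).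
Proof.
move=> sf j r.
pose F (x s : R) := s ^+ j * f^`(j.+1) (x * s).
have mI : measurable (`[0, 1]%classic : set (measurableTypeR R)).
  exact: measurable_itv.
have dF (x s : R) : is_derive x 1 (F ^~ s) (s ^+ j.+1 * f^`(j.+2) (x * s)).
  have h1 := @is_derive_chain _ (fun y => y * s) x _ _ (rsmooth_tower sf j.+1 (x * s))
              (is_derive_mul (is_derive_idR x) (is_derive_const s x 1)).
  apply: (is_derive_eq (is_derive_cmul (s ^+ j) h1)).
  by rewrite exprS mul1r mulr0 addr0; ring.
have [M M0 hM] := @continuous_bounded_itv (f^`(j.+2)) (- (`|r| + 1)) (`|r| + 1)
  (ltac:(have := normr_ge0 r; lra)) (@rsmooth_ctsn j.+2 f sf).
have rI : `]r - 1, r + 1[%classic r by rewrite /= in_itv /=; lra.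
have intF x : `]r - 1, r + 1[%classic x -> mu.-integrable `[0, 1] (EFin \o F x).
  by move=> _; apply: itv_integrable; exact: hadamard_integrand_cts.
have derF x s : `]r - 1, r + 1[%classic x -> `[0, 1]%classic s ->
    derivable (F ^~ s) x 1 by move=> _ _; case: (dF x s).
have intM : mu.-integrable `[0, 1] (EFin \o (cst M)).
  by apply: itv_integrable; exact: cst_continuous.
have ubF x s : `]r - 1, r + 1[%classic x -> `[0, 1]%classic s ->
    `|partial1of2 F x s| <= cst M s.
  rewrite /= !in_itv /= => /andP[x1 x2] /andP[s0 s1].
  rewrite partial1of2E (@derive_val _ _ _ _ _ _ _ (dF x s)) normrM.
  have sp : `|s ^+ j.+1| <= 1 by rewrite normrX exprn_ile1 // ger0_norm.
  have hb : `|f^`(j.+2) (x * s)| <= M.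
    apply: hM; rewrite -ler_norml normrM (ger0_norm s0).
    have : `|x| <= `|r| + 1.
      have -> : x = r + (x - r) by ring.
      apply: (le_trans (ler_normD _ _)); rewrite lerD2l ler_norml; lra.
    move=> hx; apply: le_trans hx; rewrite -[leRHS]mulr1.
    exact: ler_wpM2l.
  by rewrite -[leRHS]mul1r; apply: ler_pM.
split.
  exact: (derivable_under_integral mI rI intF derF (fun=> M0) intM ubF).
rewrite -derive1E.
rewrite (differentiation_under_integral mI rI intF derF (fun=> M0) intM ubF).
apply: eq_Rintegral => s _.
by rewrite partial1of2E (@derive_val _ _ _ _ _ _ _ (dF r s)).
Qed.

Lemma hadamardE f : rsmooth f -> f 0 = 0 ->
  forall r, r * hadamard f 0 r = f r.
Proof.
move=> sf f0 r; rewrite /hadamard -RintegralZl //; last first.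
  by apply: itv_integrable; exact: hadamard_integrand_cts.
have dG (s : R) : is_derive s 1 (fun s => f (r * s)) (r * (s ^+ 0 * f^`() (r * s))).
  apply: (is_derive_eq (is_derive_chain (rsmooth_is_derive (r * s) sf)
            (is_derive_scale r s))).
  by rewrite expr0 mul1r mulrC.
rewrite /Rintegral (@continuous_FTC2 _ _ (fun s => f (r * s))) //.
- by rewrite mulr0 mulr1 f0 /= subr0.
- apply: continuous_subspaceT => s; apply: cvgM; first exact: cvg_cst.
  exact: (@hadamard_integrand_cts f 0 r sf s).
- split; first by move=> s _; case: (dG s).
  + apply: cvg_at_right_filter; exact: is_derive_continuous (dG 0).
  + apply: cvg_at_left_filter; exact: is_derive_continuous (dG 1).
- by move=> s _; exact: is_derive_derive1.
Qed.

Lemma hadamard_le f j r M : rsmooth f -> (forall x, `|f^`(j.+1) x| <= M) ->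
  `|hadamard f j r| <= M.
Proof.
move=> sf hM.
have M0 : 0 <= M by exact: le_trans (hM 0).
have cI := @hadamard_integrand_cts f j r sf.
apply: (le_trans (le_normr_Rintegral _ _)); [by []|exact: itv_integrable|].
have -> : M = \int[mu]_(s in `[0, 1]) M.
  rewrite Rintegral_cst //= lebesgue_measure_itv /= lte_fin ltr01.
  by rewrite -EFinB /= subr0 mulr1.
apply: le_Rintegral; [by []| | |].
- by apply: itv_integrable; exact: cts_norm.
- by apply: itv_integrable; exact: cst_continuous.
- move=> s; rewrite /= in_itv /= => /andP[s0 s1]; rewrite normrM.
  rewrite -[leRHS]mul1r; apply: ler_pM => //.
    by rewrite normrX exprn_ile1 // ger0_norm.
  exact: hM.
Qed.

(** Leibniz' formula for the identity r * hadamard f 0 r = f r. *)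
Lemma hadamard_rec f j r : rsmooth f -> f 0 = 0 ->
  r * hadamard f j r + j%:R * hadamard f j.-1 r = f^`(j) r.
Proof.
move=> sf f0; elim: j r => [|j ih] r; first by rewrite mul0r addr0 hadamardE.
have tK := hadamard_tower sf.
have dj : is_derive r 1 (fun r => j%:R * hadamard f j.-1 r)
                        (j%:R * hadamard f j r).
  case: j {ih} => [|j]; last exact: is_derive_cmul.
  have -> : (fun r : R => 0%:R * hadamard f 0.-1 r) = (fun=> 0).
    by apply/funext => y; exact: mul0r.
  have -> : 0%:R * hadamard f 0 r = 0 by exact: mul0r.
  exact: is_derive_const.
have := is_derive_add (is_derive_mul (is_derive_idR r) (tK j r)) dj.
rewrite (_ : (fun y : R => _) = f^`(j)); last by apply/funext => y; rewrite ih.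
move=> /(is_derive_unique (rsmooth_tower sf j r)) ->.
rewrite -natr1; move: (hadamard f j.+1 r) (hadamard f j r) (j%:R) => u w c.
ring.
Qed.

(** Division by the variable, with the value at 0 that makes the quotient smooth
    when f is smooth and f 0 = 0. *)
Definition quot f (r : R) : R := if r == 0 then f^`() 0 else f r / r.

Lemma quot_hadamard f : rsmooth f -> f 0 = 0 -> quot f = hadamard f 0.
Proof.
move=> sf f0; apply/funext => r; rewrite /quot; case: eqVneq => [->|r0]; last first.
  by rewrite -(hadamardE sf f0) mulrC mulKf.
rewrite /hadamard; under eq_Rintegral do rewrite mul0r expr0 mul1r.
rewrite Rintegral_cst //= lebesgue_measure_itv /= lte_fin ltr01.
by rewrite -EFinB /= subr0 mulr1.
Qed.

Lemma quotE f : f 0 = 0 -> forall r, r * quot f r = f r.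
Proof.
move=> f0 r; rewrite /quot; case: eqVneq => [->|r0]; first by rewrite mul0r.
by rewrite mulrC divfK.
Qed.

Lemma rsmooth_quot f : rsmooth f -> f 0 = 0 -> rsmooth (quot f).
Proof.
move=> sf f0; rewrite quot_hadamard //.
exact: (@tower_rsmooth (hadamard f) (hadamard_tower sf)).
Qed.

Lemma quot_derive1n f n : rsmooth f -> f 0 = 0 ->
  (quot f)^`(n) = hadamard f n.
Proof.
by move=> sf f0; rewrite quot_hadamard // tower_derive1n //; exact: hadamard_tower.
Qed.

End Smooth.

(** * Parity and rapid decrease *)

Section Parity.
Context {R : realType}.
Implicit Types (f g E : R -> R).

Definition evenf f := forall x, f (- x) = f x.
Definition oddf f := forall x, f (- x) = - f x.

Lemma is_derive_reflect f (x a : R) : is_derive (- x) 1 f a ->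
  is_derive x 1 (fun y => f (- y)) (- a).
Proof.
move=> df; apply: (is_derive_eq (is_derive_chain df (is_derive_opp x))).
by rewrite mulrN1.
Qed.

Lemma oddf_derive E : rsmooth E -> evenf E -> oddf E^`().
Proof.
move=> sE eE x; apply/esym.
have := is_derive_reflect (rsmooth_is_derive (- x) sE).
have -> : (fun y => E (- y)) = E by apply/funext => y; rewrite eE.
by move=> /(is_derive_unique (rsmooth_is_derive x sE)) ->; rewrite opprK.
Qed.

Lemma oddf0 f : oddf f -> f 0 = 0.
Proof. by move=> fo; have := fo 0; rewrite oppr0; lra. Qed.

Lemma evenf_quot f : oddf f -> evenf (quot f).
Proof.
move=> fo x; rewrite /quot oppr_eq0; case: eqP => // _.
by rewrite fo invrN mulrNN.
Qed.

Lemma evenf_normr E x : evenf E -> E `|x| = E x.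
Proof. by move=> eE; case: (ler0P x) => // _; rewrite eE. Qed.

Definition odd_part f (r : R) := f r - f (- r).

Lemma oddf_odd_part f : oddf (odd_part f).
Proof. by move=> x; rewrite /odd_part opprK opprB. Qed.

Lemma odd_part_tower f : rsmooth f ->
  tower (fun j r => f^`(j) r - (-1) ^+ j * f^`(j) (- r)).
Proof.
move=> sf j r; have tf := rsmooth_tower sf.
have h := is_derive_cmul ((-1) ^+ j) (is_derive_reflect (tf j (- r))).
apply: (is_derive_eq (is_derive_sub (tf j r) h)).
by rewrite exprS mulN1r mulrN mulNr.
Qed.

Lemma odd_partE f :
  odd_part f = (fun r => f^`(0) r - (-1) ^+ 0 * f^`(0) (- r)).
Proof. by apply/funext => r; rewrite expr0 mul1r. Qed.

Lemma odd_part_derive1n f j : rsmooth f ->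
  (odd_part f)^`(j) = fun r => f^`(j) r - (-1) ^+ j * f^`(j) (- r).
Proof.
by move=> sf; rewrite odd_partE (tower_derive1n (odd_part_tower sf)).
Qed.

Lemma rsmooth_odd_part f : rsmooth f -> rsmooth (odd_part f).
Proof.
by move=> sf; rewrite odd_partE; exact: (tower_rsmooth (odd_part_tower sf)).
Qed.

(** The profile on the half-line of the radial function obtained from f: an even
    smooth function, which is 2 f (r) / r when f is odd. *)
Definition profile f : R -> R := quot (odd_part f).

(** The derivation with respect to half of the squared radius: if E is even and
    smooth then so is E' (r) / r. *)
Definition evendiv E : R -> R := quot E^`().

Lemma rsmooth_profile f : rsmooth f -> rsmooth (profile f).
Proof.
move=> sf; apply: rsmooth_quot; first exact: rsmooth_odd_part.
exact/oddf0/oddf_odd_part.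
Qed.

Lemma evenf_profile f : evenf (profile f).
Proof. exact/evenf_quot/oddf_odd_part. Qed.

Lemma rsmooth_evendiv E : rsmooth E -> evenf E -> rsmooth (evendiv E).
Proof.
move=> sE eE; apply: rsmooth_quot; first exact: rsmooth_derive.
exact/oddf0/oddf_derive.
Qed.

Lemma evenf_evendiv E : rsmooth E -> evenf E -> evenf (evendiv E).
Proof. by move=> sE eE; exact/evenf_quot/oddf_derive. Qed.

Lemma rsmooth_iter_evendiv E m : rsmooth E -> evenf E ->
  rsmooth (iter m evendiv E) /\ evenf (iter m evendiv E).
Proof.
move=> sE eE; elim: m => [//|m [sm em]]; rewrite iterS.
by split; [exact: rsmooth_evendiv|exact: evenf_evendiv].
Qed.

(** Domination of the Schwartz seminorms of order at most N. All continuity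
    estimates are stated as implications between such bounds, because these
    compose without handling suprema. *)
Definition bnd f (N : nat) (M : R) := forall n j, (n <= N)%N -> (j <= N)%N ->
  forall r, `|r| ^+ n * `|f^`(j) r| <= M.

Lemma bnd_ge0 f N M : bnd f N M -> 0 <= M.
Proof.
move=> /(_ 0%N 0%N (leq0n _) (leq0n _) 0); apply: le_trans.
by rewrite mulr_ge0.
Qed.

Lemma bnd_le f N N' M : (N <= N')%N -> bnd f N' M -> bnd f N M.
Proof.
by move=> NN h n j nN jN r; apply: h; [exact: leq_trans NN|exact: leq_trans NN].
Qed.

Lemma bnd_derive f N M : bnd f N.+1 M -> bnd f^`() N M.
Proof.
by move=> h n j nN jN r; rewrite -derive1Sn; apply: h => //; exact: leqW.
Qed.

Lemma bnd_odd_part f N M : rsmooth f -> bnd f N M -> bnd (odd_part f) N (2 * M).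
Proof.
move=> sf h n j nN jN r; rewrite odd_part_derive1n //.
have h1 := h n j nN jN r; have := h n j nN jN (- r); rewrite normrN => h2.
have ab : `|f^`(j) r - (-1) ^+ j * f^`(j) (- r)| <=
    `|f^`(j) r| + `|f^`(j) (- r)|.
  by apply: (le_trans (ler_normB _ _)); rewrite lerD2l normrM normrX normrN1
    expr1n mul1r.
apply: (le_trans (ler_wpM2l _ ab)); first by rewrite exprn_ge0.
by rewrite mulrDr; lra.
Qed.

(** Near 0 the quotient is controlled by the derivatives of f through Hadamard's
    integral, away from 0 by Leibniz' formula; the factorials bound the constants
    c_j = 1 + j c_(j-1) that the latter produces. *)
Lemma bnd_quot f N M : rsmooth f -> f 0 = 0 -> bnd f N.+1 M ->
  bnd (quot f) N ((N.+1)`!%:R * M).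
Proof.
move=> sf f0 h; have M0 := bnd_ge0 h.
suff key j : (j <= N)%N -> forall n, (n <= N)%N -> forall r,
    `|r| ^+ n * `|hadamard f j r| <= (j.+1)`!%:R * M.
  move=> n j nN jN r; rewrite quot_derive1n //; apply: (le_trans (key j jN n nN r)).
  by apply: ler_wpM2r => //; rewrite ler_nat; exact: leq_fact.
have small i n r : (i <= N)%N -> `|r| <= 1 ->
    `|r| ^+ n * `|hadamard f i r| <= (i.+1)`!%:R * M.
  move=> iN r1; apply: (@le_trans _ _ (1 * M)).
    apply: ler_pM; [exact: exprn_ge0|by []|exact: exprn_ile1|].
    apply: hadamard_le => // x.
    by have := h 0%N i.+1 (leq0n _) iN x; rewrite expr0 mul1r.
  by apply: ler_wpM2r => //; rewrite ler1n fact_gt0.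
elim: j => [|j ih] jN n nN r.
all: have [r1|r1] := leP `|r| 1; first exact: small.
all: have step a : `|r| ^+ n * `|a| <= `|r| ^+ n * `|r * a|
  by apply: ler_wpM2l; [exact: exprn_ge0|rewrite normrM ler_peMl // ltW].
- apply: (le_trans (step _)); rewrite hadamardE // mul1r.
  exact: (h n 0%N (leqW nN) isT).
- apply: (le_trans (step _)).
  have -> : r * hadamard f j.+1 r = f^`(j.+1) r - j.+1%:R * hadamard f j r.
    by rewrite -(hadamard_rec j.+1 r sf f0) /= addrK.
  have hf := h n j.+1 (leqW nN) (leqW jN) r.
  have hk := ih (ltnW jN) n nN r.
  apply: (@le_trans _ _ (`|r| ^+ n * (`|f^`(j.+1) r| + j.+1%:R * `|hadamard f j r|))).
    apply: ler_wpM2l; first exact: exprn_ge0.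
    by apply: (le_trans (ler_normB _ _)); rewrite normrM normr_nat.
  rewrite mulrDr mulrCA.
  apply: (@le_trans _ _ (M + j.+1%:R * (j.+1`!%:R * M))).
    by apply: lerD => //; apply: ler_wpM2l.
  rewrite mulrA -natrM -[X in X + _]mul1r -mulrDl; apply: ler_wpM2r => //.
  by rewrite nat1r ler_nat [(j.+2)`!]factS mulSn -addn1 addnC leq_add2r fact_gt0.
Qed.

End Parity.

(** * The chain rule for functions of the radius *)

Section RadiusChainRule.
Context {R : realType}.
Implicit Types (E g : R -> R).

(** A function of sqrt g is differentiable even where g vanishes: there E is even,
    so that E (r) = E (0) + r^2 kappa (r) with kappa continuous, and g has a
    minimum. *)
Lemma is_derive_radius E g (t a : R) : rsmooth E -> evenf E ->
  (forall x, 0 <= g x) -> (forall x, derivable g x 1) -> is_derive t 1 g a ->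
  is_derive t 1 (fun x => E (Num.sqrt (g x)))
    (a / 2 * evendiv E (Num.sqrt (g t))).
Proof.
move=> sE eE g0 dg dga.
have [gt|gt] := eqVneq (g t) 0; last first.
  have gtp : 0 < g t by rewrite lt_neqAle eq_sym gt g0.
  have sp : 0 < Num.sqrt (g t) by rewrite sqrtr_gt0.
  have hs := is_derive_chain (is_derive1_sqrt gtp) dga.
  apply: (is_derive_eq (@is_derive_chain _ E (fun x => Num.sqrt (g x)) t _ _
    (rsmooth_is_derive (Num.sqrt (g t)) sE) hs)).
  rewrite -[in LHS](quotE (oddf0 (oddf_derive sE eE))) -/(evendiv E).
  by field; rewrite gt_eqF.
have a0 : a = 0.
  apply: (is_derive_unique dga).
  apply: (@derive1_at_min _ g (t - 1) (t + 1) t); first by lra.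
  - by move=> x _; exact: dg.
  - by rewrite in_itv /=; apply/andP; split; lra.
  - by move=> x _; rewrite gt.
rewrite a0 in dga *; rewrite !mul0r => {a a0}.
pose E0 r := E r - E 0.
have sE0 : rsmooth E0.
  have tE0 : tower (fun n => if n is n'.+1 then E^`(n'.+1) else E0).
    case=> [|n] x; last exact: rsmooth_tower.
    apply: (is_derive_eq (is_derive_sub (rsmooth_is_derive x sE)
      (is_derive_const (E 0) x 1))).
    by rewrite subr0.
  exact: (tower_rsmooth tE0).
have E00 : E0 0 = 0 by rewrite /E0 subrr.
have dE0 : E0^`() 0 = 0.
  have h := is_derive_sub (rsmooth_is_derive (0 : R) sE) (is_derive_const (E 0) (0 : R) 1).
  by rewrite (is_derive_derive1 h) subr0 (oddf0 (oddf_derive sE eE)).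
have q0 : quot E0 0 = 0 by rewrite /quot eqxx.
have sq := rsmooth_quot sE0 E00.
pose kappa := quot (quot E0).
have Ek r : E r = E 0 + r ^+ 2 * kappa r.
  by rewrite expr2 -mulrA quotE // quotE // /E0 addrC subrK.
have ck : continuous kappa by exact/rsmooth_cts/rsmooth_quot.
have cg : {for t, continuous g} := is_derive_continuous dga.
apply: cvg_is_derive.
have -> : (fun h => h^-1 * (E (Num.sqrt (g (h + t))) - E (Num.sqrt (g t)))) =
    (fun h => (h^-1 * (g (h + t) - g t)) * kappa (Num.sqrt (g (h + t)))).
  apply/funext => h; rewrite gt sqrtr0 subr0 [in LHS]Ek sqr_sqrtr // addrC addKr.
  by rewrite mulrA.
rewrite -[X in _ --> X](mul0r (kappa (Num.sqrt (g t)))).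
apply: cvgM; first exact: is_derive_cvg.
have ch : {for 0, continuous (fun h : R => kappa (Num.sqrt (g (h + t))))}.
  have c1 : {for 0, continuous (fun h : R => g (h + t))}.
    apply: (@continuous_comp _ _ _ (fun h : R => h + t) g); last by rewrite add0r.
    by apply: cvgD; [exact: cvg_id|exact: cvg_cst].
  apply: (@continuous_comp _ _ _ (fun h : R => Num.sqrt (g (h + t))) kappa);
    last exact: ck.
  by apply: (@continuous_comp _ _ _ (fun h : R => g (h + t)) Num.sqrt);
    last exact: sqrt_continuous.
rewrite /prop_for /continuous_at add0r in ch.
exact: cvg_within_filter ch.
Qed.

End RadiusChainRule.

(** * Integrals of continuous functions with compact support *)

Section CompactSupport.
Context {R : realType}.
Implicit Types (f g F G : R -> R).
Local Notation mu := (@lebesgue_measure R).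

Definition primitive F f := forall x : R, is_derive x 1 F (f x).

Definition supp_in (L : R) f := forall x, L < `|x| -> f x = 0.

Definition cc f := continuous f /\ exists L, supp_in L f.

Lemma supp_in_le L L' f : L <= L' -> supp_in L f -> supp_in L' f.
Proof. by move=> LL h x hx; apply: h; exact: le_lt_trans hx. Qed.

Lemma cc_supp f : cc f -> exists2 L, 0 < L & supp_in L f.
Proof.
move=> [_ [L h]]; exists (`|L| + 1); first by rewrite ltr_wpDl.
apply: supp_in_le h; apply: (le_trans (ler_norm L)); lra.
Qed.

Lemma integral_supp (A B : R) f : (forall x, ~~ (A <= x <= B) -> f x = 0) ->
  integralR f = \int[mu]_(x in `[A, B]) f x.
Proof.
move=> h; rewrite [RHS]Rintegral_mkcond; apply: eq_Rintegral => x _.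
rewrite patchE; case: ifPn => //; rewrite notin_setE /= in_itv /= => /negP hx.
by rewrite h.
Qed.

Lemma cc_integrable f : cc f -> mu.-integrable setT (EFin \o f).
Proof.
move=> [cf [L hL]].
have -> : EFin \o f = (EFin \o f) \_ `[- L, L].
  apply/funext => x; rewrite patchE; case: ifPn => //=.
  rewrite notin_setE /= in_itv /= => /negP; rewrite -ler_norml -ltNge => hx.
  by rewrite hL.
apply: (integrable_mkcond _ _).1; first exact: measurable_itv.
exact: itv_integrable.
Qed.

Lemma integral_FTC (A B : R) f F : A < B -> continuous f ->
  (forall x, ~~ (A <= x <= B) -> f x = 0) ->
  primitive F f -> integralR f = F B - F A.
Proof.
move=> AB cf h dF; rewrite (integral_supp h) /Rintegral.
rewrite (@continuous_FTC2 _ f F) //.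
- exact: continuous_subspaceT.
- split; first by move=> x _; case: (dF x).
  + apply: cvg_at_right_filter; exact: is_derive_continuous (dF A).
  + apply: cvg_at_left_filter; exact: is_derive_continuous (dF B).
- by move=> x _; exact: is_derive_derive1.
Qed.

Lemma supp_itv L f : supp_in L f -> forall x, ~~ (- L <= x <= L) -> f x = 0.
Proof. by move=> h x; rewrite -ler_norml -ltNge => /h. Qed.

Lemma antiderivative f : cc f -> exists F, primitive F f.
Proof.
move=> ccf; have [cf _] := ccf; have fi := cc_integrable ccf.
exists (fun x => \int[mu]_(t in [set` Interval -oo%O (BRight x)]) f t) => x.
have fx : mu.-integrable [set` Interval -oo%O (BRight (x + 1))] (EFin \o f).
  by apply: integrableS fi.
have := @continuous_FTC1 _ f -oo%O x (x + 1) _ fx _ (cf x).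
case; [by lra|by rewrite ltNyr|move=> d e].
by rewrite -e; exact: derivable_is_derive.
Qed.

Lemma integral_eq f g : (forall x, f x = g x) -> integralR f = integralR g.
Proof. by move=> fg; apply: eq_Rintegral => x _. Qed.

Lemma integral0 : integralR (fun=> 0 : R) = 0.
Proof. by rewrite /integralR Rintegral_cst // mul0r. Qed.

Lemma integralD f g : cc f -> cc g ->
  integralR (fun x => f x + g x) = integralR f + integralR g.
Proof. by move=> cf cg; apply: RintegralD; [|exact: cc_integrable..]. Qed.

Lemma integralZ (c : R) f : cc f ->
  integralR (fun x => c * f x) = c * integralR f.
Proof. by move=> cf; apply: RintegralZl; [|exact: cc_integrable]. Qed.

Lemma cc_mul f g : cc f -> continuous g -> cc (fun x => f x * g x).
Proof.
move=> [cf [L h]] cg; split; first exact: cts_mul.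
by exists L => x hx; rewrite h // mul0r.
Qed.

Lemma cc_cmul (c : R) f : cc f -> cc (fun x => c * f x).
Proof.
move=> [cf [L h]]; split; first by apply: cts_mul => //; exact: cts_const.
by exists L => x hx; rewrite h // mulr0.
Qed.

Lemma cc_add f g : cc f -> cc g -> cc (fun x => f x + g x).
Proof.
move=> ccf ccg; have [L L0 h] := cc_supp ccf; have [L' L0' h'] := cc_supp ccg.
split; first by apply: cts_add; [exact: ccf.1|exact: ccg.1].
by exists (L + L') => x hx; rewrite h ?h' ?addr0 //; lra.
Qed.

Lemma cc_reflect f : cc f -> cc (fun x => f (- x)).
Proof.
move=> [cf [L h]]; split; last by exists L => x hx; rewrite h // normrN.
by apply: cts_comp => // x; apply: cvgN; exact: cvg_id.
Qed.

Lemma cc_scale f (a : R) : 0 < a -> cc f -> cc (fun x => f (a * x)).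
Proof.
move=> a0 [cf [L h]]; split; first by apply: cts_comp => //; exact: cts_scale.
exists (L / a) => x hx; apply: h; rewrite normrM (gtr0_norm a0) mulrC.
by rewrite -ltr_pdivrMr.
Qed.

Lemma integral_shift f (c : R) : cc f ->
  integralR (fun x => f (x + c)) = integralR f.
Proof.
move=> ccf; have [L L0 h] := cc_supp ccf; have [cf _] := ccf.
have [F dF] := antiderivative ccf.
rewrite (@integral_FTC (- L) L f F) //; [|lra|exact: supp_itv].
rewrite (@integral_FTC (- L - c) (L - c) _ (fun x => F (x + c))); first last.
- move=> x; have h1 := is_derive_add (is_derive_idR x) (is_derive_const c x 1).
  apply: (is_derive_eq (@is_derive_chain _ F (fun x => x + c) x _ _ (dF _) h1)).
  by rewrite addr0 mulr1.
- move=> x hx; apply: (supp_itv h); apply: contra hx; lra.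
- by apply: cts_comp => //; apply: cts_add; [exact: cts_id|exact: cts_const].
- lra.
- by congr (F _ - F _); lra.
Qed.

Lemma integral_scale f (a : R) : 0 < a -> cc f ->
  a * integralR (fun x => f (a * x)) = integralR f.
Proof.
move=> a0 ccf; have [L L0 h] := cc_supp ccf; have [cf _] := ccf.
have [F dF] := antiderivative ccf; have an0 : a != 0 by rewrite gt_eqF.
rewrite (@integral_FTC (- L) L f F) //; [|lra|exact: supp_itv].
rewrite (@integral_FTC (- (L / a)) (L / a) _ (fun x => a^-1 * F (a * x))); first last.
- move=> x.
  apply: (is_derive_eq (is_derive_cmul a^-1
    (@is_derive_chain _ F (fun x => a * x) x _ _ (dF _) (is_derive_scale a x)))).
  by rewrite mulrCA mulVf // mulr1.
- move=> x hx; apply: (supp_itv h); apply: contra hx => /andP[h1 h2].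
  apply/andP; split; first by rewrite -mulNr ler_pdivrMr // mulrC.
  by rewrite ler_pdivlMr // mulrC.
- by apply: cts_comp => //; exact: cts_scale.
- have : 0 < L / a by rewrite divr_gt0.
  lra.
- rewrite -mulrBr mulrA divff // mul1r; congr (F _ - F _).
  + by rewrite mulrC divfK.
  + by rewrite mulrN mulrC divfK.
Qed.

Lemma integral_reflect f : cc f -> integralR (fun x => f (- x)) = integralR f.
Proof.
move=> ccf; have [L L0 h] := cc_supp ccf; have [cf _] := ccf.
have [F dF] := antiderivative ccf.
rewrite (@integral_FTC (- L) L f F) //; [|lra|exact: supp_itv].
rewrite (@integral_FTC (- L) L _ (fun x => - F (- x))); first last.
- move=> x; apply: (is_derive_eq (is_deriveN (is_derive_reflect (dF (- x))))).
  by rewrite opprK.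
- by apply: supp_itv => x hx; apply: h; rewrite normrN.
- exact: (cc_reflect ccf).1.
- lra.
- by rewrite opprK opprK addrC.
Qed.

Lemma integral_parts F G f g :
  primitive F f -> primitive G g ->
  cc f -> cc F -> continuous g ->
  integralR (fun x => f x * G x) = - integralR (fun x => F x * g x).
Proof.
move=> dF dG ccf ccF cg; have [L L0 h] := cc_supp ccF.
have [L' L0' h'] := cc_supp ccf.
have cG : continuous G by move=> x; exact: is_derive_continuous (dG x).
apply/eqP; rewrite -addr_eq0 -integralD; [|exact: cc_mul..].
rewrite (@integral_FTC (- (L + L' + 1)) (L + L' + 1) _ (fun x => F x * G x)); first last.
- by move=> x; exact: is_derive_mul.
- move=> x; rewrite -ler_norml -ltNge => hx.
  by rewrite h ?h' ?mul0r ?addr0 //; lra.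
- by apply: cts_add; apply: cts_mul => //; [exact: ccf.1|exact: ccF.1].
- lra.
- by rewrite !h ?mul0r ?subr0 //; [rewrite normrN|]; rewrite ger0_norm; lra.
Qed.

(** Continuity of an integral depending on a parameter, under domination that is
    uniform for the parameter near each point. *)
Lemma integral_continuous (h : R -> R -> R) :
  (forall w, continuous (h w)) -> (forall t, continuous (h ^~ t)) ->
  (forall w0, exists M L, 0 <= M /\ forall w, `|w - w0| < 1 ->
     (forall t, `|h w t| <= M) /\ supp_in L (h w)) ->
  continuous (fun w => integralR (h w)).
Proof.
move=> c1 c2 dom w0; have [M [L [M0 hML]]] := dom w0.
have eqI w : `|w - w0| < 1 ->
    integralR (h w) = \int[mu]_(t in `[- L, L]) h w t.
  by move=> /hML [_ hs]; rewrite (integral_supp (supp_itv hs)).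
have w0I : `]w0 - 1, w0 + 1[%classic w0 by rewrite /= in_itv /=; lra.
have mI : measurable (`[- L, L]%classic : set (measurableTypeR R)).
  exact: measurable_itv.
have inI w : `]w0 - 1, w0 + 1[%classic w -> `|w - w0| < 1.
  by rewrite /= in_itv /= ltr_norml; lra.
have cont : {in `]w0 - 1, w0 + 1[%classic,
    continuous (fun w => \int[mu]_(t in `[- L, L]) h w t)}.
  apply: (@continuity_under_integral R _ _ mu h _ mI _ _ _ _ (cst M)).
  - by move=> w _; exact: itv_integrable.
  - by apply: aeW => t _ w _; exact: c2.
  - by apply: itv_integrable; exact: cts_const.
  - by move=> w /inI /hML [hb _]; apply: aeW => t _; exact: hb.
have := cont w0 (mem_set w0I).
rewrite /continuous_at -(eqI w0) ?subrr ?normr0 //; apply: cvg_trans.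
apply: near_eq_cvg; near=> w; apply/esym/eqI.
near: w; apply/nbhs_ballP; exists 1 => //= w; rewrite /ball /= distrC //.
Unshelve. all: by end_near. Qed.

Lemma cc_norm f : cc f -> cc (fun x => `|f x|).
Proof.
move=> [cf [L h]]; split; first exact: cts_norm.
by exists L => x hx; rewrite h // normr0.
Qed.

Lemma EFin_integral f : cc f ->
  (\int[mu]_x (f x)%:E = (integralR f)%:E)%E.
Proof.
move=> cf; rewrite /integralR /Rintegral fineK //.
exact: (integrable_fin_num measurableT (cc_integrable cf)).
Qed.

Lemma integral_swap (F : R -> R -> R) (G : R -> R) :
  measurable_fun [set: measurableTypeR R * measurableTypeR R]
    (fun z => F z.1 z.2) ->
  (forall x, cc (F x)) -> (forall y, cc (F ^~ y)) ->
  mu.-integrable setT (EFin \o G) ->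
  (forall y, integralR (fun x => `|F x y|) <= G y) ->
  integralR (fun x => integralR (F x)) =
  integralR (fun y => integralR (F ^~ y)).
Proof.
move=> mF c1 c2 iG hG.
have /measurable_EFinP mf := mF.
have bound : (\int[mu]_y \int[mu]_x `|(F x y)%:E| < +oo)%E.
  apply: (@le_lt_trans _ _ (\int[mu]_y (`|G y|)%:E)%E).
    apply: ge0_le_integral => //.
    - by move=> y _; apply: integral_ge0 => x _; exact: abse_ge0.
    - have mn := measurableT_comp (@abse_measurable R setT) mf.
      exact: (@measurable_fun_fubini_tonelli_G _ _ _ _ _ mu _ mn (fun z => abse_ge0 _)).
    - apply/measurable_EFinP; apply: measurableT_comp => //.
      by apply/measurable_EFinP; case/integrableP: iG.
    - move=> y _ /=.
      rewrite (_ : \int[mu]_x _ = \int[mu]_x (`|F x y|)%:E)%E //.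
      rewrite EFin_integral; last exact: (cc_norm (c2 y)).
      by rewrite lee_fin; apply: (le_trans (hG y)); exact: ler_norm.
  by case/integrableP: iG.
have If := (@integrable21ltyP _ _ _ _ _ mu mu _ mf).2 bound.
have := @Fubini _ _ _ _ _ mu mu _ If; rewrite /= => FE.
rewrite {1 3}/integralR /Rintegral; congr fine.
transitivity (\int[mu]_x \int[mu]_y (F x y)%:E)%E.
  by apply: eq_integral => x _; rewrite EFin_integral.
rewrite FE; apply: eq_integral => y _; rewrite EFin_integral //; exact: c2.
Qed.

End CompactSupport.

(** * Integrating out two variables *)

Section Polar.
Context {R : realType}.
Implicit Types (f g p q : R -> R).
Local Notation mu := (@lebesgue_measure R).

(** The pairs (q, p) of functions of w = |x|^2 with p = - q' / pi, stated as a chain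
    rule along nonnegative functions, since q need not be differentiable at 0 when
    it is extended by a constant to negative arguments. *)
Record polar_pair q p : Prop := PolarPair {
  polar_q : continuous q;
  polar_p : continuous p;
  polar_supp : exists L, forall w, L < w -> q w = 0 /\ p w = 0;
  polar_der : forall g (t a : R), (forall x, 0 <= g x) ->
    (forall x : R, derivable g x 1) -> is_derive t 1 g a ->
    is_derive t 1 (fun x => q (g x)) (- pi * a * p (g t)) }.

Definition vanish_above (L : R) f := forall w, L < w -> f w = 0.

Lemma vanish_above_ge1 f L : vanish_above L f ->
  exists2 L', 1 <= L' & vanish_above L' f.
Proof.
move=> h; exists (`|L| + 1) => [|w hw]; first by rewrite lerDr.
by apply: h; apply: le_lt_trans hw; have := ler_norm L; lra.
Qed.

Lemma sqr_gt_norm (L x : R) : 1 <= L -> L < `|x| -> L < x ^+ 2.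
Proof.
move=> L1 Lx; rewrite -real_normK ?num_real //; apply: (lt_le_trans Lx).
by rewrite expr2 ler_peMl //; lra.
Qed.

Lemma cc_radial (s : R) f L : continuous f -> vanish_above L f -> 0 <= s ->
  cc (fun x => f (s + x ^+ 2)).
Proof.
move=> cf hf s0; split.
  apply: cts_comp => //; apply: cts_add; first exact: cts_const.
  by apply: cts_mul; exact: cts_id.
have [L' L1 h] := vanish_above_ge1 hf; exists L' => x hx; apply: h.
by have := sqr_gt_norm L1 hx; lra.
Qed.

Lemma integral_punctured f g : continuous f -> (forall x, x != 0 -> f x = g x) ->
  integralR f = integralR g.
Proof.
move=> cf fg; rewrite /integralR /Rintegral; congr fine.
have mD : measurable ([set: measurableTypeR R] `\ (0 : R)) by exact: measurableD.
have mf : measurable_fun ([set: measurableTypeR R] `\ (0 : R)) f.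
  exact: measurable_funTS (continuous_measurable_fun cf).
have fgD : {in [set: measurableTypeR R] `\ (0 : R), f =1 g}.
  by move=> x; rewrite inE /= => -[_ /eqP]; exact: fg.
have mg := eq_measurable_fun _ fgD mf.
rewrite -(@integral_setD1 _ _ 0 setT) //; last exact/measurable_EFinP.
rewrite -[RHS](@integral_setD1 _ _ 0 setT) //; last exact/measurable_EFinP.
by apply: eq_integral => x /fgD ->.
Qed.

Lemma integral_oneDsqr : integralR (fun u : R => (oneDsqr u)^-1) = pi.
Proof.
rewrite /integralR /Rintegral ge0_symfun_integralT.
- rewrite (_ : [set x | _] = `[0, +oo[%classic); last first.
    by apply/seteqP; split => x /=; rewrite in_itv /= andbT.
  by rewrite integral0y_oneDsqr -EFinM /= mulrC divfK.
- by move=> x; rewrite invr_ge0; exact: le_trans (oneDsqr_ge1 x).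
- exact: continuous_oneDsqrV.
- by move=> x; rewrite /= /oneDsqr sqrrN.
Qed.

Lemma integrable_oneDsqr (C : R) : 0 <= C ->
  mu.-integrable setT (EFin \o (fun u : R => C / oneDsqr u)).
Proof.
move=> C0.
have pos (x : R) : 0 <= (oneDsqr x)^-1.
  by rewrite invr_ge0; exact: le_trans (oneDsqr_ge1 x).
have I1 : mu.-integrable setT (EFin \o (fun u : R => (oneDsqr u)^-1)).
  apply/integrableP; split.
    apply/measurable_EFinP; apply: continuous_measurable_fun.
    exact: continuous_oneDsqrV.
  under eq_integral do rewrite /= ger0_norm //.
  have := @ge0_symfun_integralT R (fun u => (oneDsqr u)^-1) pos
    (@continuous_oneDsqrV R).
  move=> -> ; last by move=> x; rewrite /= /oneDsqr sqrrN.
  rewrite (_ : [set x | _] = `[0, +oo[%classic); last first.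
    by apply/seteqP; split => x /=; rewrite in_itv /= andbT.
  by rewrite integral0y_oneDsqr -EFinM ltry.
rewrite (_ : _ \o _ = (fun x => C%:E * (EFin \o (fun u : R => (oneDsqr u)^-1)%R) x)%E) //.
exact: integrableZl.
Qed.

Section OnePair.
Context (q p : R -> R) (s : R) (qp : polar_pair q p) (s0 : 0 <= s).

Let vq : exists L, vanish_above L q.
Proof. by have [L h] := polar_supp qp; exists L => w /h []. Qed.

Let vp : exists L, vanish_above L p.
Proof. by have [L h] := polar_supp qp; exists L => w /h []. Qed.

Let lt_shift (u v : R) : u < v -> u < s + v.
Proof. by move=> uv; apply: (lt_le_trans uv); rewrite lerDr. Qed.

Let cc_p : cc (fun y => `|y| * p (s + y ^+ 2)).
Proof.
have [L h] := vp; have := cc_radial (polar_p qp) h s0 => -[c [L' h']].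
split; first by apply: cts_mul => //; apply: cts_norm; exact: cts_id.
by exists L' => x hx; rewrite h' // mulr0.
Qed.

Lemma is_derive_polar (y : R) :
  is_derive y 1 (fun y => q (s + y ^+ 2)) (- (2 * pi) * (y * p (s + y ^+ 2))).
Proof.
have dg (x : R) : is_derive x 1 (fun y => s + y ^+ 2) (2 * x).
  apply: (is_derive_eq (is_derive_add (is_derive_const s x 1) (is_derive_sq x))).
  by rewrite add0r.
have h := polar_der qp (fun x => addr_ge0 s0 (sqr_ge0 x))
  (fun x => let: DeriveDef d _ := dg x in d) (dg y).
by apply: (is_derive_eq h); ring.
Qed.

Lemma integral_radial1 :
  integralR (fun y => `|y| * p (s + y ^+ 2)) = q s / pi.
Proof.
have [F dF] := antiderivative cc_p.
have [L hL] := vp; have [L1 L11 h1] := vanish_above_ge1 hL.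
have [L2 hL2] := vq; have [L3 L31 h3] := vanish_above_ge1 hL2.
pose B := L1 + L3.
have B0 : 0 < B by rewrite /B; lra.
have qB (x : R) : `|x| = B -> q (s + x ^+ 2) = 0.
  move=> xB; apply: h3; apply/lt_shift/sqr_gt_norm => //.
  by rewrite xB /B; lra.
have F2 : integralR (fun y => `|y| * p (s + y ^+ 2)) = F B - F (- B).
  apply: integral_FTC => //; [lra|exact: cc_p.1|].
  apply: supp_itv => x hx; rewrite h1 ?mulr0 //.
  by apply/lt_shift/sqr_gt_norm => //; move: hx; rewrite /B; lra.
have pi0 : pi != 0 :> R by rewrite gt_eqF // pi_gt0.
(* F + c q (s + y^2) is constant on the half-line where c has the sign of y. *)
have cst_side (c a b : R) : a < b -> (forall y, a < y < b -> `|y| = 2 * pi * c * y) ->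
    F b - F a = - c * (q (s + b ^+ 2) - q (s + a ^+ 2)).
  move=> ab hc.
  pose D y := F y + c * q (s + y ^+ 2).
  have dD (y : R) : is_derive y 1 D
      (`|y| * p (s + y ^+ 2) + c * (- (2 * pi) * (y * p (s + y ^+ 2)))).
    exact: is_derive_add (dF y) (is_derive_cmul c (is_derive_polar y)).
  have cD : {within `[a, b], continuous D}.
    by apply: continuous_subspaceT => y; exact: is_derive_continuous (dD y).
  have [y yab] := MVT ab (fun y _ => dD y) cD.
  rewrite in_itv /= in yab; rewrite hc // /D => e.
  have : F b + c * q (s + b ^+ 2) - (F a + c * q (s + a ^+ 2)) = 0.
    by rewrite e; ring.
  lra.
have s1 := cst_side (2 * pi)^-1 0 B B0.
have s2 := cst_side (- (2 * pi)^-1) (- B) 0 (ltac:(lra)).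
rewrite F2 -[F B](subrK (F 0)) -addrA s1; last first.
  by move=> y /andP[y0 _]; rewrite gtr0_norm // divff ?mul1r // mulf_neq0 ?pnatr_eq0.
rewrite s2; last first.
  move=> y /andP[_ y0]; rewrite ltr0_norm // mulrN divff ?mulN1r //.
  by rewrite mulf_neq0 ?pnatr_eq0.
rewrite (qB B) ?(qB (- B)) ?normrN ?gtr0_norm //.
have -> : s + 0 ^+ 2 = s by rewrite expr2 mul0r addr0.
have key (c Q : R) : c != 0 ->
  - (2 * c)^-1 * (0 - Q) + - - (2 * c)^-1 * (Q - 0) = Q / c by move=> c0; field.
exact: key pi0.
Qed.

(** Polar coordinates without angles: the substitution y = |x| u and Fubini's theorem
    leave the integral of |x| p (s + x^2), which is q (s) / pi, times the integral of
    1 / (1 + u^2), which is pi. *)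
Lemma integral_polar :
  integralR (fun x => integralR (fun y => p (s + x ^+ 2 + y ^+ 2))) = q s.
Proof.
have cp := polar_p qp; have [L hL] := vp.
have [L1 L11 h1] := vanish_above_ge1 hL.
have cca (x : R) : cc (fun y => p (s + x ^+ 2 + y ^+ 2)).
  by apply: cc_radial hL _ => //; rewrite addr_ge0 // sqr_ge0.
pose F (x u : R) := `|x| * p (s + x ^+ 2 * oneDsqr u).
have one0 (u : R) : 0 < oneDsqr u by exact: lt_le_trans (oneDsqr_ge1 u).
have csq : continuous (fun x : R => x ^+ 2) by apply: cts_mul; exact: cts_id.
have ccu (x : R) : cc (F x).
  split.
    apply: cts_mul; first exact: cts_const.
    apply: cts_comp => //; apply: cts_add; first exact: cts_const.
    apply: cts_mul; first exact: cts_const.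
    by apply: cts_add => //; exact: cts_const.
  have [->|x0] := eqVneq x 0; first by exists 0 => u _; rewrite /F normr0 mul0r.
  have x2 : 0 < x ^+ 2 by rewrite exprn_even_gt0.
  exists (L1 / x ^+ 2 + 1) => u hu; rewrite /F h1 ?mulr0 //.
  have : L1 / x ^+ 2 + 1 < u ^+ 2.
    by apply: sqr_gt_norm => //; rewrite lerDr divr_ge0 //; lra.
  move=> hu2; have : L1 / x ^+ 2 < oneDsqr u by rewrite /oneDsqr; lra.
  rewrite ltr_pdivrMr // mulrC; exact: lt_shift.
(* Rescaling x by (1 + u^2)^(1/2) separates the variables. *)
have resc (h : R -> R) (u : R) : cc (fun y => `|y| * h (s + y ^+ 2)) ->
    integralR (fun x => `|x| * h (s + x ^+ 2 * oneDsqr u)) =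
    integralR (fun y => `|y| * h (s + y ^+ 2)) / oneDsqr u.
  move=> ch; set a := Num.sqrt (oneDsqr u).
  have a0 : 0 < a by rewrite sqrtr_gt0.
  have a2 : a ^+ 2 = oneDsqr u by rewrite sqr_sqrtr // ltW.
  have an0 : a != 0 by rewrite gt_eqF.
  rewrite -(integral_scale a0 ch) -a2.
  under [LHS]integral_eq => x.
    rewrite (_ : _ * _ = a^-1 * (`|a * x| * h (s + (a * x) ^+ 2))); last first.
      by rewrite normrM (gtr0_norm a0) exprMn (mulrC (a ^+ 2)) !mulrA mulVf // mul1r.
    over.
  rewrite integralZ; first by field.
  exact: cc_scale a0 ch.
have ccx (u : R) : cc (F ^~ u).
  split.
    apply: cts_mul; first by apply: cts_norm; exact: cts_id.
    apply: cts_comp => //; apply: cts_add; first exact: cts_const.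
    by apply: cts_mul => //; exact: cts_const.
  exists L1 => x hx; rewrite /F h1 ?mulr0 //.
  have := sqr_gt_norm L11 hx => hx2.
  apply: lt_shift; apply: (lt_le_trans hx2).
  by rewrite ler_peMr ?sqr_ge0 ?oneDsqr_ge1.
have mF : measurable_fun [set: measurableTypeR R * measurableTypeR R]
    (fun z => F z.1 z.2).
  apply: measurable_funM; first exact: measurableT_comp measurable_fst.
  apply: measurableT_comp; first exact: continuous_measurable_fun.
  apply: measurable_funD => //; apply: measurable_funM.
    by apply: measurable_funX; exact: measurable_fst.
  apply: measurable_funD => //; apply: measurable_funX; exact: measurable_snd.
have cca_p : cc (fun y => `|y| * `|p (s + y ^+ 2)|).
  by have := cc_norm cc_p; under eq_fun do rewrite normrM normr_id.
(* The substitution y = |x| u degenerates at x = 0 only. *)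
rewrite (@integral_punctured _ (fun x => integralR (F x))); first last.
- move=> x x0; have xp : 0 < `|x| by rewrite normr_gt0.
  rewrite -(integral_scale xp (cca x)) -integralZ.
    apply: integral_eq => u; rewrite /F /oneDsqr exprMn.
    by rewrite (real_normK (num_real x)) mulrDr mulr1 addrA.
  exact: cc_scale xp (cca x).
- apply: integral_continuous.
  + by move=> x; exact: (cca x).1.
  + move=> y; apply: cts_comp => //; apply: cts_add; last exact: cts_const.
    by apply: cts_add => //; exact: cts_const.
  + move=> w0; have [M M0 hM] := continuous_bounded_itv (le_trans ler01 L11) cp.
    exists M, L1; split=> // x _; split=> [y|y hy]; last first.
      apply: h1; rewrite -addrA; apply/lt_shift/(lt_le_trans (sqr_gt_norm L11 hy)).
      by rewrite lerDr sqr_ge0.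
    have [hl|hl] := leP (s + x ^+ 2 + y ^+ 2) L1; last by rewrite h1 // normr0.
    by apply: hM; rewrite hl andbT !addr_ge0 // sqr_ge0.
pose C := integralR (fun y => `|y| * `|p (s + y ^+ 2)|).
have C0 : 0 <= C by apply: Rintegral_ge0 => y _; exact: mulr_ge0.
rewrite (@integral_swap _ F (fun u => C / oneDsqr u)) //; first last.
- move=> u; rewrite -(resc (fun w => `|p w|)) //.
  by under [leLHS]integral_eq do rewrite normrM normr_id.
- exact: integrable_oneDsqr.
under integral_eq => u do rewrite (resc p) // integral_radial1.
rewrite /integralR RintegralZl //; last first.
  have := @integrable_oneDsqr 1 ler01.
  by under [X in EFin \o X]eq_fun do rewrite mul1r.
rewrite -/(integralR _) integral_oneDsqr divfK //.
by rewrite gt_eqF // pi_gt0.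
Qed.

End OnePair.

End Polar.

(** * Rotation invariance in the plane *)

Section Plane.
Context {R : realType}.
Implicit Types (F : R -> R -> R).
Local Notation mu := (@lebesgue_measure R).

(** Measurability for the product sigma-algebra is kept beside joint continuity,
    from which it would follow only by a countability argument on the open sets of
    the plane; shears preserve both. *)
Record cc2 F : Prop := CC2 {
  cc2_meas : measurable_fun [set: measurableTypeR R * measurableTypeR R]
    (fun z => F z.1 z.2);
  cc2_cts : continuous (fun z : R * R => F z.1 z.2);
  cc2_supp : exists L : R, forall x y : R, L < `|x| \/ L < `|y| -> F x y = 0 }.

Lemma cts_fst : continuous (fun z : R * R => z.1).
Proof. by move=> z; exact: cvg_fst. Qed.

Lemma cts_snd : continuous (fun z : R * R => z.2).
Proof. by move=> z; exact: cvg_snd. Qed.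

Lemma cts_plane (T : topologicalType) (u v : T -> R) F :
  continuous u -> continuous v -> continuous (fun z : R * R => F z.1 z.2) ->
  continuous (fun t => F (u t) (v t)).
Proof.
move=> cu cv cF t.
apply: (@continuous_comp _ _ _ (fun t => (u t, v t)) (fun z : R * R => F z.1 z.2));
  last exact: cF.
exact: (cvg_pair (cu t) (cv t)).
Qed.

Definition integral2 F := integralR (fun x => integralR (F x)).

Lemma cc2_row F x : cc2 F -> cc (F x).
Proof.
move=> [_ cF [L h]]; split; last by exists L => y hy; apply: h; right.
apply: (@cts_plane _ (fun=> x) (fun y => y)) => //; [exact: cts_const|exact: cts_id].
Qed.

Lemma cc2_col F y : cc2 F -> cc (F ^~ y).
Proof.
move=> [_ cF [L h]]; split; last by exists L => x hx; apply: h; left.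
apply: (@cts_plane _ (fun x => x) (fun=> y)) => //; [exact: cts_id|exact: cts_const].
Qed.

Lemma integral2_eq F G : (forall x y, F x y = G x y) -> integral2 F = integral2 G.
Proof. by move=> FG; apply: integral_eq => x; apply: integral_eq. Qed.

Lemma cc2_bounded F : cc2 F -> exists2 M, 0 <= M & forall x y, `|F x y| <= M.
Proof.
move=> [_ cF [L h]].
pose A : set (R * R) := `[- `|L|, `|L|] `*` `[- `|L|, `|L|].
have cA : compact A by apply: compact_setX; exact: segment_compact.
have A0 : A !=set0.
  by exists (0, 0); split; rewrite /= in_itv /= oppr_le0 normr_ge0.
have cn : {within A, continuous (fun z : R * R => `|F z.1 z.2|)}.
  by apply: continuous_subspaceT; exact: cts_norm.
have [c _ hc] := compact_EVT_max A0 cA cn.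
exists `|F c.1 c.2| => // x y.
have [hx|hx] := leP `|x| L; last by rewrite h ?normr0 //; left.
have [hy|hy] := leP `|y| L; last by rewrite h ?normr0 //; right.
have LL := ler_norm L.
apply: (hc (x, y)); rewrite inE; split; rewrite /= in_itv /= -ler_norml.
  exact: le_trans LL.
exact: le_trans LL.
Qed.

Lemma cc2_swap F : cc2 F -> integral2 F = integral2 (fun x y => F y x).
Proof.
move=> cF; have [M M0 hM] := cc2_bounded cF; have [L hL] := cc2_supp cF.
pose B := `|L| + 1; have B0 : 0 < B by rewrite ltr_wpDl.
have LB : L < B by rewrite /B; have := ler_norm L; lra.
pose G := (cst (M * (B + B))) \_ `[- B, B] : R -> R.
apply: (@integral_swap _ F G).
- exact: cc2_meas.
- by move=> x; exact: cc2_row.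
- by move=> y; exact: cc2_col.
- rewrite /G -restrict_EFin; apply: (integrable_mkcond _ _).1; first by [].
  by apply: itv_integrable; exact: cts_const.
- move=> y; rewrite /G patchE; case: ifPn => [_|]; last first.
    rewrite notin_setE /= in_itv /= => /negP; rewrite -ler_norml -ltNge => hy.
    rewrite (_ : integralR _ = 0) //.
    rewrite -[RHS]integral0; apply: integral_eq => x.
    by rewrite hL ?normr0 //; right; exact: lt_trans hy.
  have s1 : supp_in B (fun x => `|F x y|).
    by move=> x hx; rewrite hL ?normr0 //; left; exact: lt_trans hx.
  have cn := (cc_norm (cc2_col y cF)).1.
  rewrite (integral_supp (supp_itv s1)).
  apply: (@le_trans _ _ (\int[mu]_(x in `[- B, B]) M)).
    apply: le_Rintegral => //; first exact: itv_integrable.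
    by apply: itv_integrable; exact: cts_const.
  rewrite Rintegral_cst //= lebesgue_measure_itv /= lte_fin.
  by rewrite ifT ?opprK //; lra.
Qed.

Lemma cc2_transpose F : cc2 F -> cc2 (fun x y => F y x).
Proof.
move=> [mF cF [L h]]; split.
- have := measurableT_comp mF (measurable_fun_pair measurable_snd measurable_fst).
  exact.
- by have := cts_plane cts_snd cts_fst cF.
- by exists L => x y [hx|hy]; apply: h; [right|left].
Qed.

Lemma cc2_shear F (a : R) : cc2 F -> cc2 (fun x y => F x (y + a * x)).
Proof.
move=> [mF cF [L h]]; split.
- apply: (measurableT_comp mF (measurable_fun_pair measurable_fst _)).
  apply: measurable_funD; first exact: measurable_snd.
  by apply: measurable_funM => //; exact: measurable_fst.
- apply: (@cts_plane _ (fun z => z.1) (fun z => z.2 + a * z.1)) => //.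
    exact: cts_fst.
  apply: cts_add; first exact: cts_snd.
  by apply: cts_mul; [exact: cts_const|exact: cts_fst].
- exists (`|L| + `|a| * `|L|) => x y hxy; apply: h.
  have LL := ler_norm L.
  have aL : 0 <= `|a| * `|L| by exact: mulr_ge0.
  have [hx|hx] := leP `|x| L; last by left.
  right; case: hxy => hy; first by lra.
  have : `|y| <= `|y + a * x| + `|a * x|.
    by rewrite -[X in `|X| <= _](addrK (a * x)); exact: ler_normB.
  have : `|a * x| <= `|a| * `|L|.
    by rewrite normrM ler_wpM2l //; exact: le_trans LL.
  lra.
Qed.

Lemma integral2_shear F (a : R) : cc2 F ->
  integral2 (fun x y => F x (y + a * x)) = integral2 F.
Proof.
move=> cF; apply: integral_eq => x.
exact: (integral_shift (a * x) (cc2_row x cF)).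
Qed.

Lemma cc2_shear' F (a : R) : cc2 F -> cc2 (fun x y => F (x + a * y) y).
Proof. by move=> /cc2_transpose /(cc2_shear a) /cc2_transpose. Qed.

Lemma integral2_shear' F (a : R) : cc2 F ->
  integral2 (fun x y => F (x + a * y) y) = integral2 F.
Proof.
move=> cF; rewrite cc2_swap; last exact: cc2_shear'.
rewrite (integral2_shear a (cc2_transpose cF)).
by rewrite cc2_swap //; exact: cc2_transpose.
Qed.

(** A rotation other than the identity and the half-turn is a product of three
    shears, and each shear preserves a double integral by translation invariance
    in one variable. *)
Lemma rotation_shears F (c s : R) : c ^+ 2 + s ^+ 2 = 1 -> s != 0 -> cc2 F ->
  let G := fun x y => F (c * x - s * y) (s * x + c * y) in
  cc2 G /\ integral2 G = integral2 F.
Proof.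
move=> cs s0 cF G; pose t := (1 - c) / s.
have st : s * t = 1 - c by rewrite /t mulrC divfK.
have tc : t * (1 + c) = s.
  apply: (mulfI s0); rewrite mulrA st.
  have -> : (1 - c) * (1 + c) = 1 - c ^+ 2 by ring.
  by rewrite -cs; ring.
have GE : G = fun x y =>
    F ((x + - t * y) + - t * (y + s * (x + - t * y))) (y + s * (x + - t * y)).
  apply/funext => x; apply/funext => y; rewrite /G.
  congr F.
  - transitivity ((1 - s * t) * x - (t * (1 + (1 - s * t))) * y); last by ring.
    by rewrite st (_ : 1 - (1 - c) = c) ?tc //; ring.
  - transitivity (s * x + (1 - s * t) * y); last by ring.
    by rewrite st; ring.
have c1 := cc2_shear' (- t) cF; have c2 := cc2_shear s c1.
have c3 := cc2_shear' (- t) c2.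
rewrite GE; split; first exact: c3.
by rewrite (integral2_shear' (- t) c2) (integral2_shear s c1) integral2_shear'.
Qed.

Lemma integral2_rotation F (c s : R) : c ^+ 2 + s ^+ 2 = 1 -> cc2 F ->
  integral2 (fun x y => F (c * x - s * y) (s * x + c * y)) = integral2 F.
Proof.
move=> cs cF; have [s0|s0] := eqVneq s 0; last exact: (rotation_shears cs s0 cF).2.
have : (c == 1) || (c == -1).
  by rewrite -sqrf_eq1 -cs s0 (expr2 0) mul0r addr0.
case/orP => /eqP c1; first by apply: integral2_eq => x y; rewrite s0 c1; congr F; ring.
(* The half-turn is a quarter-turn done twice. *)
have q01 : 0 ^+ 2 + 1 ^+ 2 = 1 :> R by ring.
have [cG eG] := rotation_shears q01 (oner_neq0 _) cF.
have [_ eH] := rotation_shears q01 (oner_neq0 _) cG.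
rewrite -eG -eH; apply: integral2_eq => x y; rewrite s0 c1.
by congr F; ring.
Qed.

Lemma integral2_radial (g : R -> R -> R) (u v : R) :
  cc2 (fun x y => g (x ^+ 2 + y ^+ 2) (u * x + v * y)) ->
  integral2 (fun x y => g (x ^+ 2 + y ^+ 2) (u * x + v * y)) =
  integral2 (fun x y => g (x ^+ 2 + y ^+ 2) (Num.sqrt (u ^+ 2 + v ^+ 2) * x)).
Proof.
move=> cF; set r := Num.sqrt _.
have r2 : r ^+ 2 = u ^+ 2 + v ^+ 2 by rewrite sqr_sqrtr // addr_ge0 // sqr_ge0.
have [r0|r0] := eqVneq r 0.
  have uv : u ^+ 2 + v ^+ 2 = 0 by rewrite -r2 r0 expr0n.
  have u0 : u = 0 by apply/eqP; rewrite -sqrf_eq0; apply/eqP; nra.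
  have v0 : v = 0 by apply/eqP; rewrite -sqrf_eq0; apply/eqP; nra.
  by apply: integral2_eq => x y; rewrite u0 v0 r0 !mul0r addr0.
have cs : (u / r) ^+ 2 + (v / r) ^+ 2 = 1.
  by rewrite !exprMn -mulrDl -r2 exprVn divff // expf_neq0.
rewrite -(integral2_rotation cs cF); apply: integral2_eq => x y; congr g.
- transitivity (((u / r) ^+ 2 + (v / r) ^+ 2) * (x ^+ 2 + y ^+ 2)); first by ring.
  by rewrite cs mul1r.
- transitivity ((u ^+ 2 + v ^+ 2) / r * x); first by field.
  by rewrite -r2 expr2 mulfK.
Qed.

Lemma cc2_radial (P c : R -> R) (L u v : R) : continuous P -> vanish_above L P ->
  continuous c -> cc2 (fun x y => P (x ^+ 2 + y ^+ 2) * c (u * x + v * y)).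
Proof.
move=> cP vP cc_; split.
- apply: measurable_funM.
    apply: measurableT_comp; first exact: continuous_measurable_fun.
    by apply: measurable_funD; apply: measurable_funX;
      [exact: measurable_fst|exact: measurable_snd].
  apply: measurableT_comp; first exact: continuous_measurable_fun.
  apply: measurable_funD; apply: measurable_funM => //.
- have [c1 c2] := (cts_fst, cts_snd).
  apply: cts_mul; apply: cts_comp => //; apply: cts_add.
  + exact: cts_mul.
  + exact: cts_mul.
  + by apply: cts_mul => //; exact: cts_const.
  + by apply: cts_mul => //; exact: cts_const.
- have [L' L1 h] := vanish_above_ge1 vP; exists L' => x y hxy.
  rewrite h ?mul0r //; have := sqr_ge0 x; have := sqr_ge0 y.
  by case: hxy => /(sqr_gt_norm L1); lra.
Qed.

Lemma cc2_add F G : cc2 F -> cc2 G -> cc2 (fun x y => F x y + G x y).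
Proof.
move=> [mF cF [L h]] [mG cG [L' h']]; split.
- exact: measurable_funD.
- exact: cts_add.
- exists (Num.max L L') => x y; rewrite !gt_max => hxy.
  by rewrite h ?h' ?addr0 //; case: hxy => /andP[]; tauto.
Qed.

End Plane.

(** * From three dimensions to one *)

Section ThreeToOne.
Context {R : realType}.
Implicit Types (p q c : R -> R).

(** Sums of two products are carried along, because the real and imaginary parts
    of (f1 + i f2) exp (i theta) have this form and the iterated integral over
    R^k would otherwise have to be shown additive. *)
Definition sum2 p1 c1 p2 c2 (w v : R) : R := p1 w * c1 v + p2 w * c2 v.

Lemma polar_vanish q p : polar_pair q p ->
  exists L, vanish_above L q /\ vanish_above L p.
Proof. by move=> [_ _ [L h] _]; exists L; split => w /h []. Qed.

Lemma cc2_sum2 (P1 P2 c1 c2 : R -> R) (L u v w0 v0 : R) : 0 <= w0 ->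
  continuous P1 -> vanish_above L P1 -> continuous P2 -> vanish_above L P2 ->
  continuous c1 -> continuous c2 ->
  cc2 (fun x y => sum2 P1 c1 P2 c2 (w0 + (x ^+ 2 + y ^+ 2)) (v0 + (u * x + v * y))).
Proof.
move=> w00 cP1 vP1 cP2 vP2 cc1 cc2'.
have sh (a : R) (h : R -> R) : continuous h -> continuous (fun x => h (a + x)).
  by move=> ch; apply: cts_comp => //; apply: cts_add; [exact: cts_const|exact: cts_id].
have vs (h : R -> R) : vanish_above L h -> vanish_above L (fun x => h (w0 + x)).
  by move=> vh x hx; apply: vh; lra.
by apply: cc2_add; apply: (@cc2_radial _ (fun x => _ (w0 + x)) (fun x => _ (v0 + x)) L);
  (exact: sh || exact: vs).
Qed.

(** Integrals of p over parallel lines, as a function of the squared distance of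
    the line to the origin. *)
Definition line_integral p (s w : R) := integralR (fun z => p (s + w + z ^+ 2)).

Lemma line_integral_cts p s L : continuous p -> vanish_above L p ->
  continuous (line_integral p s).
Proof.
move=> cp vp; have csq : continuous (fun z : R => z ^+ 2).
  by apply: cts_mul; exact: cts_id.
apply: integral_continuous.
- move=> w; apply: cts_comp => //; apply: cts_add => //; exact: cts_const.
- move=> z; apply: cts_comp => //; apply: cts_add; last exact: cts_const.
  by apply: cts_add; [exact: cts_const|exact: cts_id].
- move=> w0; set a := s + w0 - 1.
  pose B := `|L| + `|a| + 1.
  have LL := ler_norm L; have aa := ler_norm (- a); rewrite normrN in aa.
  have na := ler_norm a; have n0 := normr_ge0 L; have n1 := normr_ge0 a.
  have [M M0 hM] := @continuous_bounded_itv _ p a B (ltac:(rewrite /B; lra)) cp.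
  exists M, B; split=> // w; rewrite ltr_norml => /andP[w1 w2]; split=> z.
    have [hl|hl] := leP (s + w + z ^+ 2) B; last first.
      by rewrite vp ?normr0 //; move: hl; rewrite /B; lra.
    by apply: hM; rewrite hl andbT /a; have := sqr_ge0 z; lra.
  have B1 : 1 <= B by rewrite /B; lra.
  move=> /(sqr_gt_norm B1); rewrite /B => hz; apply: vp; move: aa hz; rewrite /a; lra.
Qed.

Lemma line_integral_vanish p s L : 0 <= s -> vanish_above L p ->
  vanish_above L (line_integral p s).
Proof.
move=> s0 vp w hw; rewrite /line_integral -[RHS]integral0; apply: integral_eq => z.
by apply: vp; have := sqr_ge0 z; lra.
Qed.

Lemma cc_sum2 p1 c1 p2 c2 (s w L : R) (v : R -> R) : 0 <= s + w ->
  continuous p1 -> vanish_above L p1 -> continuous p2 -> vanish_above L p2 ->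
  continuous c1 -> continuous c2 -> continuous v ->
  cc (fun z => sum2 p1 c1 p2 c2 (s + w + z ^+ 2) (v z)).
Proof.
move=> sw cp1 vp1 cp2 vp2 cc1 cc2' cv.
by apply: cc_add; apply: cc_mul; (exact: cts_comp || exact: (cc_radial _ (L := L))).
Qed.

Lemma integral_sum2_line p1 c1 p2 c2 (s w v L : R) : 0 <= s + w ->
  continuous p1 -> vanish_above L p1 -> continuous p2 -> vanish_above L p2 ->
  integralR (fun z => sum2 p1 c1 p2 c2 (s + w + z ^+ 2) v) =
  sum2 (line_integral p1 s) c1 (line_integral p2 s) c2 w v.
Proof.
move=> sw cp1 vp1 cp2 vp2; rewrite /sum2 /line_integral.
have r1 := cc_radial cp1 vp1 sw; have r2 := cc_radial cp2 vp2 sw.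
rewrite [_ * c1 v]mulrC [_ * c2 v]mulrC -!integralZ //.
rewrite -integralD; [|exact: cc_cmul..].
by apply: integral_eq => z; rewrite [c1 v * _]mulrC [c2 v * _]mulrC.
Qed.

(** Two rotations align the frequency with the first axis; the other two variables
    are then integrated out by integral_polar. *)
Lemma integral_three_to_one (q1 p1 c1 q2 p2 c2 : R -> R) (s n1 n2 n3 : R) :
  polar_pair q1 p1 -> polar_pair q2 p2 -> continuous c1 -> continuous c2 ->
  0 <= s ->
  integralR (fun x => integralR (fun y => integralR (fun z =>
    sum2 p1 c1 p2 c2 (s + x ^+ 2 + y ^+ 2 + z ^+ 2) (n1 * x + n2 * y + n3 * z)))) =
  integralR (fun t => sum2 q1 c1 q2 c2 (s + t ^+ 2)
    (Num.sqrt (n1 ^+ 2 + (n2 ^+ 2 + n3 ^+ 2)) * t)).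
Proof.
move=> qp1 qp2 cc1 cc2' s0; set r' := Num.sqrt _.
have [L1 [_ v1]] := polar_vanish qp1; have [L2 [_ v2]] := polar_vanish qp2.
have [cp1 cp2] := (polar_p qp1, polar_p qp2).
pose L := Num.max L1 L2.
have {}v1 : vanish_above L p1 by move=> w; rewrite gt_max => /andP[/v1].
have {}v2 : vanish_above L p2 by move=> w; rewrite gt_max => /andP[_ /v2].
set r := Num.sqrt (n2 ^+ 2 + n3 ^+ 2).
have r2 : r ^+ 2 = n2 ^+ 2 + n3 ^+ 2 by rewrite sqr_sqrtr // addr_ge0 ?sqr_ge0.
have sx (x : R) : 0 <= s + x ^+ 2 by rewrite addr_ge0 ?sqr_ge0.
(* Rotating (y, z) removes z from the argument of the c_i. *)
transitivity (integralR (fun x => integralR (fun y => integralR (fun z =>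
    sum2 p1 c1 p2 c2 (s + (x ^+ 2 + y ^+ 2) + z ^+ 2) (n1 * x + r * y))))).
  apply: integral_eq => x.
  have := @integral2_radial _ (fun w v =>
    sum2 p1 c1 p2 c2 (s + x ^+ 2 + w) (n1 * x + v)) n2 n3
    (cc2_sum2 _ _ _ (sx x) cp1 v1 cp2 v2 cc1 cc2').
  rewrite -/r => e; transitivity (integral2 (fun y z => sum2 p1 c1 p2 c2
    (s + x ^+ 2 + (y ^+ 2 + z ^+ 2)) (n1 * x + (n2 * y + n3 * z)))).
    by apply: integral2_eq => y z; rewrite !addrA.
  by rewrite e; apply: integral2_eq => y z; rewrite !addrA.
pose J1 := line_integral p1 s; pose J2 := line_integral p2 s.
have J1c : continuous J1 by exact: line_integral_cts v1.
have J2c : continuous J2 by exact: line_integral_cts v2.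
have J1v : vanish_above L J1 by exact: line_integral_vanish.
have J2v : vanish_above L J2 by exact: line_integral_vanish.
have xy (x y : R) : 0 <= s + (x ^+ 2 + y ^+ 2) by rewrite !addr_ge0 ?sqr_ge0.
transitivity (integral2 (fun x y => sum2 J1 c1 J2 c2 (x ^+ 2 + y ^+ 2)
    (n1 * x + r * y))).
  by apply: integral2_eq => x y; rewrite (@integral_sum2_line p1 c1 p2 c2 s _ _ L).
rewrite (@integral2_radial _ (sum2 J1 c1 J2 c2)); last first.
  have := cc2_sum2 n1 r 0 (lexx 0) J1c J1v J2c J2v cc1 cc2'.
  by under eq_fun do under eq_fun do rewrite !add0r.
have -> : Num.sqrt (n1 ^+ 2 + r ^+ 2) = r' by rewrite r2.
apply: integral_eq => x; rewrite /sum2.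
have pJ q p : polar_pair q p -> vanish_above L p ->
    integralR (fun y => line_integral p s (x ^+ 2 + y ^+ 2)) = q (s + x ^+ 2).
  move=> qp vp; rewrite -(integral_polar qp (sx x)); apply: integral_eq => y.
  by apply: integral_eq => z; rewrite !addrA.
have cJ p : continuous p -> vanish_above L p ->
    cc (fun y => line_integral p s (x ^+ 2 + y ^+ 2)).
  move=> cp vp; apply: (@cc_radial _ (x ^+ 2) _ L); last exact: sqr_ge0.
    exact: line_integral_cts vp.
  exact: line_integral_vanish.
rewrite -(pJ _ _ qp1 v1) -(pJ _ _ qp2 v2).
rewrite [integralR _ * _]mulrC [X in _ = _ + X]mulrC -!integralZ; [|exact: cJ..].
rewrite -integralD; [|exact/cc_cmul/cJ..].
by apply: integral_eq => y; rewrite mulrC [J2 _ * _]mulrC.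
Qed.

End ThreeToOne.

(** * The Fourier integral of a radial function in odd dimension *)

Section RadialFourier.
Context {R : realType}.

Let dotv_row_mx1 k (t u : R) (x y : 'rV[R]_k) :
  dotv (row_mx (t%:M : 'rV_1) x) (row_mx (u%:M : 'rV_1) y) = t * u + dotv x y.
Proof.
rewrite /dotv big_split_ord /= big_ord_recl big_ord0 addr0.
congr (_ + _); first by rewrite !row_mxEl !mxE.
by apply: eq_bigr => i _; rewrite !row_mxEr.
Qed.

Lemma dotv_row_mx k (t u : R) (x y : 'rV[R]_k) :
  @dotv R k.+1 (row_mx (t%:M : 'rV_1) x) (row_mx (u%:M : 'rV_1) y) =
  t * u + dotv x y.
Proof. exact: dotv_row_mx1. Qed.

Lemma row_mx_surj k (x : 'rV[R]_k.+1) :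
  exists t y, x = row_mx (t%:M : 'rV_1) y :> 'rV_(1 + k).
Proof.
exists ((lsubmx (x : 'rV_(1 + k))) 0 0), (rsubmx (x : 'rV_(1 + k))).
by rewrite -mx11_scalar hsubmxK.
Qed.

Lemma dotv_ge0 k (x : 'rV[R]_k) : 0 <= dotv x x.
Proof. by apply: sumr_ge0 => i _; rewrite -expr2 sqr_ge0. Qed.

Lemma enorm_sqr k (x : 'rV[R]_k) : enorm x ^+ 2 = dotv x x.
Proof. by rewrite sqr_sqrtr // dotv_ge0. Qed.

Lemma integralRk_eq k (f g : 'rV[R]_k -> R) : (forall x, f x = g x) ->
  integralRk f = integralRk g.
Proof. by move=> fg; congr integralRk; exact/funext. Qed.

Lemma integralRkS k (f : 'rV[R]_k.+1 -> R) : integralRk f =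
  integralR (fun t => integralRk (fun x => f (row_mx (t%:M : 'rV_1) x))).
Proof. by []. Qed.

(** Each step removes two dimensions: with the first two coordinates fixed, the
    induction hypothesis turns the integral over the others into one over a line,
    and the resulting triple integral is an integral over a line again. *)
Lemma integralRk_radial m (p1 p2 : nat -> R -> R) (c1 c2 : R -> R) :
  continuous (p1 0%N) -> (exists L, vanish_above L (p1 0%N)) ->
  continuous (p2 0%N) -> (exists L, vanish_above L (p2 0%N)) ->
  (forall i, polar_pair (p1 i) (p1 i.+1)) ->
  (forall i, polar_pair (p2 i) (p2 i.+1)) ->
  continuous c1 -> continuous c2 ->
  forall (s : R) (xi : 'rV[R]_(m.*2.+1)), 0 <= s ->
  integralRk (fun x => sum2 (p1 m) c1 (p2 m) c2 (s + dotv x x) (dotv xi x)) =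
  integralR (fun t => sum2 (p1 0%N) c1 (p2 0%N) c2 (s + t ^+ 2) (enorm xi * t)).
Proof.
elim: m p1 p2 c1 c2 => [|m ih] p1 p2 c1 c2 cp1 [L1 v1] cp2 [L2 v2] qp1 qp2 cc1 cc2'
  s xi s0.
  have [n [e xiE]] := row_mx_surj xi.
  rewrite integralRkS /= xiE.
  have d0 (x y : 'rV[R]_0) : dotv x y = 0 by rewrite /dotv big_ord0.
  transitivity (integralR (fun t => sum2 (p1 0%N) c1 (p2 0%N) c2 (s + t ^+ 2) (n * t))).
    by apply: integral_eq => t; rewrite !dotv_row_mx !d0 !addr0 -expr2.
  have -> : enorm (row_mx (n%:M : 'rV_1) e : 'rV_1) = `|n|.
    by rewrite /enorm (@dotv_row_mx 0) d0 addr0 -expr2 sqrtr_sqr.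
  have [n0|n0] := ger0P n; first by [].
  pose L := Num.max L1 L2.
  have {}v1 : vanish_above L (p1 0%N) by move=> w; rewrite gt_max => /andP[/v1].
  have {}v2 : vanish_above L (p2 0%N) by move=> w; rewrite gt_max => /andP[_ /v2].
  rewrite -integral_reflect; first by apply: integral_eq => t; rewrite sqrrN mulrN mulNr.
  have := @cc_sum2 _ (p1 0%N) c1 (p2 0%N) c2 s 0 L (fun t => n * t).
  rewrite addr0; apply => //; exact: cts_scale.
have [n1 [xi' xiE]] := row_mx_surj xi; have [n2 [xi'' xiE']] := row_mx_surj xi'.
rewrite integralRkS.
pose q1 i := p1 i.+1; pose q2 i := p2 i.+1.
transitivity (integralR (fun x => integralR (fun y => integralR (fun z =>
    sum2 (p1 1%N) c1 (p2 1%N) c2 (s + x ^+ 2 + y ^+ 2 + z ^+ 2)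
      (n1 * x + n2 * y + enorm xi'' * z))))).
  apply: integral_eq => x; rewrite integralRkS; apply: integral_eq => y.
  have sh (a : R) (h : R -> R) : continuous h -> continuous (fun x => h (a + x)).
    by move=> ch; apply: cts_comp => //; apply: cts_add; [exact: cts_const|exact: cts_id].
  have sxy : 0 <= s + x ^+ 2 + y ^+ 2 by rewrite !addr_ge0 ?sqr_ge0.
  have [M1 [_ w1]] := polar_vanish (qp1 0%N); have [M2 [_ w2]] := polar_vanish (qp2 0%N).
  have := ih q1 q2 (fun v => c1 (n1 * x + n2 * y + v)) (fun v => c2 (n1 * x + n2 * y + v))
    (polar_p (qp1 0%N)) (ex_intro _ M1 w1) (polar_p (qp2 0%N)) (ex_intro _ M2 w2)
    (fun i => qp1 i.+1) (fun i => qp2 i.+1) (sh _ _ cc1) (sh _ _ cc2') _ xi'' sxy.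
  move=> e; transitivity (integralRk (fun x0 : 'rV[R]_(m.*2.+1) =>
    sum2 (q1 m) (fun v => c1 (n1 * x + n2 * y + v)) (q2 m)
      (fun v => c2 (n1 * x + n2 * y + v)) (s + x ^+ 2 + y ^+ 2 + dotv x0 x0)
      (dotv xi'' x0))); last by rewrite e.
  apply: integralRk_eq => z; rewrite xiE xiE' !dotv_row_mx -!expr2 !addrA.
  by rewrite /sum2 /q1 /q2.
rewrite (integral_three_to_one _ _ _ (qp1 0%N) (qp2 0%N)) //.
apply: integral_eq => t; congr (sum2 _ _ _ _ _ (_ * t)).
by rewrite enorm_sqr /enorm xiE xiE' !dotv_row_mx -!expr2.
Qed.

End RadialFourier.

(** * The dimension walk on profiles *)

Section Walk.
Context {R : realType}.
Implicit Types (f E : R -> R).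

Lemma rsmooth_cmul (c : R) f : rsmooth f -> rsmooth (fun x => c * f x).
Proof.
move=> sf; have t : tower (fun n x => c * f^`(n) x).
  by move=> n x; exact: is_derive_cmul (rsmooth_tower sf n x).
exact: (tower_rsmooth t).
Qed.

Record radial_profile (L : R) E : Prop := RadialProfile {
  rp_smooth : rsmooth E;
  rp_even : evenf E;
  rp_supp : supp_in L E }.

(** If E is the profile of a function on R^k, then walk E is the profile of the
    function on R^(k+2) with the same radial Fourier transform. *)
Definition walk E : R -> R := fun r => - (2 * pi)^-1 * evendiv E r.

Lemma supp_in_derive L f : supp_in L f -> supp_in L f^`().
Proof.
move=> h x hx.
have near0 : \forall y \near x, (fun=> 0) y = f y.
  have : \forall y \near x, L < `|y|.
    have : (fun y => `|y|) @ x --> `|x| by apply: cts_norm; exact: cts_id.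
    by move/cvgr_gt; apply.
  by apply: filterS => y hy; rewrite h.
exact: is_derive_derive1 (near_eq_is_derive near0 (is_derive_const 0 x 1)).
Qed.

Lemma supp_in_quot L f : 0 <= L -> supp_in L f -> supp_in L (quot f).
Proof.
move=> L0 h x hx; rewrite /quot; case: eqP => [x0|_]; last by rewrite h // mul0r.
by move: hx; rewrite x0 normr0 ltNge L0.
Qed.

Lemma walk_profile L E : 0 <= L -> radial_profile L E -> radial_profile L (walk E).
Proof.
move=> L0 [sE eE hE]; split.
- exact/rsmooth_cmul/rsmooth_evendiv.
- by move=> x; rewrite /walk evenf_evendiv.
- move=> x hx; rewrite /walk /evendiv.
  by rewrite (supp_in_quot L0 (supp_in_derive hE)) // mulr0.
Qed.

Lemma iter_walk_profile L E m : 0 <= L -> radial_profile L E ->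
  radial_profile L (iter m walk E).
Proof. by move=> L0 rE; elim: m => [//|m ih]; exact: walk_profile. Qed.

Lemma profile_sqrt_cts L E : radial_profile L E ->
  continuous (fun w => E (Num.sqrt w)).
Proof.
by move=> [sE _ _]; apply: cts_comp; [exact: sqrt_continuous|exact: rsmooth_cts].
Qed.

Lemma profile_sqrt_vanish L E : 0 <= L -> radial_profile L E ->
  vanish_above (L ^+ 2) (fun w => E (Num.sqrt w)).
Proof.
move=> L0 [_ _ h] w hw; apply: h; rewrite ger0_norm ?sqrtr_ge0 //.
rewrite -[X in X < _](ger0_norm L0) -sqrtr_sqr ltr_sqrt //.
exact: le_lt_trans (sqr_ge0 L) hw.
Qed.

Lemma walk_polar_pair L E : 0 <= L -> radial_profile L E ->
  polar_pair (fun w => E (Num.sqrt w)) (fun w => walk E (Num.sqrt w)).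
Proof.
move=> L0 rE; have rW := walk_profile L0 rE; split.
- exact: profile_sqrt_cts rE.
- exact: profile_sqrt_cts rW.
- exists (L ^+ 2) => w hw; split; first exact: (profile_sqrt_vanish L0 rE).
  exact: (profile_sqrt_vanish L0 rW).
- move=> g t a g0 dg dga; have [sE eE _] := rE.
  apply: (is_derive_eq (is_derive_radius sE eE g0 dg dga)).
  have key (c D : R) : c != 0 -> a / 2 * D = - c * a * (- (2 * c)^-1 * D).
    by move=> c0; field.
  by rewrite /walk; apply: key; rewrite gt_eqF // pi_gt0.
Qed.

Lemma quot_cmul (c : R) f : derivable f 0 1 ->
  quot (fun x => c * f x) = fun x => c * quot f x.
Proof.
move=> df; apply/funext => x; rewrite /quot; case: eqP => _; last by rewrite mulrA.
exact: is_derive_derive1 (is_derive_cmul c (derivable_is_derive df)).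
Qed.

(** The profile of a compactly supported f is one step of the walk away from a
    profile on the line: a primitive of a multiple of odd_part f is even, so that it
    takes the same constant value on both sides of the support, and subtracting this
    value makes its support compact. *)
Lemma profile_primitive L f : 0 <= L -> rsmooth f -> supp_in L f ->
  exists E, [/\ radial_profile L E, walk E = profile f &
    forall x : R, is_derive x 1 E (- (2 * pi) * odd_part f x)].
Proof.
move=> L0 sf hf; set o := odd_part f.
have so : rsmooth o := rsmooth_odd_part sf.
have oo : oddf o := @oddf_odd_part _ f.
have ho : supp_in L o by move=> x hx; rewrite /o /odd_part !hf ?normrN // subr0.
pose e x := - (2 * pi) * o x.
have cce : cc e.
  apply: cc_cmul; split; first exact: rsmooth_cts.
  by exists L.
have [F dF] := antiderivative cce.
have evF x : F (- x) = F x.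
  have dD (y : R) : is_derive y 1 (fun y => F (- y) - F y) 0.
    apply: (is_derive_eq (is_derive_sub (is_derive_reflect (dF (- y))) (dF y))).
    by rewrite /e oo; ring.
  have := is_derive_0_is_cst x 0 dD; rewrite oppr0 subrr => /eqP.
  by rewrite subr_eq0 => /eqP.
have cF : continuous F by move=> x; exact: is_derive_continuous (dF x).
have cstF x : L < x -> F x = F (L + 1).
  move=> hx.
  have side a b : L < a -> a < b -> F b = F a.
    move=> La ab.
    have [y] := MVT ab (fun y _ => dF y) (continuous_subspaceT cF).
    rewrite in_itv /= => /andP[ay _]; rewrite /e ho ?mulr0 ?mul0r.
      by move/eqP; rewrite subr_eq0 => /eqP.
    by rewrite (lt_le_trans La) // (le_trans (ltW ay)) // ler_norm.
  have [xL|xL|<- //] := ltgtP x (L + 1); first by rewrite -(side _ _ hx xL).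
  by rewrite (side (L + 1) x) //; lra.
pose E x := F x - F (L + 1).
have dE (x : R) : is_derive x 1 E (e x).
  by apply: (is_derive_eq (is_derive_sub (dF x) (is_derive_const _ x 1))); rewrite subr0.
have tE : tower (fun n => if n is n'.+1 then (fun x => - (2 * pi) * o^`(n') x) else E).
  by case=> [|n] x; [exact: dE|exact: is_derive_cmul (rsmooth_tower so n x)].
have E1 : E^`() = (fun x => - (2 * pi) * o x).
  by apply/funext => x; exact: is_derive_derive1 (dE x).
exists E; split; [split| |exact: dE].
- exact: (tower_rsmooth tE).
- by move=> x; rewrite /E evF.
- move=> x hx; rewrite /E -[F x]/(F x); case: (ler0P x) hx => [x0|x0] hx.
    by rewrite -evF cstF ?subrr.
  by rewrite cstF ?subrr.
- apply/funext => x; rewrite /walk /evendiv E1 quot_cmul; last exact: (so 0%N).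
  rewrite mulrA mulrNN mulVf ?mul1r //.
  by rewrite mulf_neq0 ?pnatr_eq0 ?gt_eqF ?pi_gt0.
Qed.

(** * The Fourier integral of a function on the line *)

Lemma integral_dilate_cts f (c : R -> R) L : continuous f -> supp_in L f ->
  continuous c -> continuous (fun r : R => integralR (fun t => f t * c (r * t))).
Proof.
move=> cf hf cc_; have cid := @cts_id R.
apply: integral_continuous.
- by move=> r; apply: cts_mul => //; apply: cts_comp => //; exact: cts_scale.
- move=> t; apply: cts_mul; first exact: cts_const.
  by apply: cts_comp => //; apply: cts_mul => //; exact: cts_const.
- move=> r0; pose B := (`|r0| + 1) * `|L|.
  have B0 : 0 <= B by rewrite /B mulr_ge0 // addr_ge0.
  have LL : - `|L| <= `|L| by have := normr_ge0 L; lra.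
  have [M M0 hM] := continuous_bounded_itv LL cf.
  have BB : - B <= B by lra.
  have [N N0 hN] := continuous_bounded_itv BB cc_.
  exists (M * N), L; split=> [|r rr0]; first exact: mulr_ge0.
  split=> t; last by move=> ht; rewrite hf // mul0r.
  have [tL|tL] := leP `|t| L; last by rewrite hf // mul0r normr0 mulr_ge0.
  have tL' : `|t| <= `|L| by apply: (le_trans tL); exact: ler_norm.
  rewrite normrM; apply: ler_pM => //; [apply: hM|apply: hN]; rewrite -ler_norml //.
  rewrite normrM; apply: ler_pM => //.
  have : `|r| <= `|r0| + `|r - r0|.
    by rewrite -[X in `|X| <= _](subrK r0) addrC; exact: ler_normD.
  by move=> h; apply: (le_trans h); rewrite lerD2l ltW.
Qed.

(** Integration by parts: multiplying by r differentiates E and integrates c. *)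
Lemma integral_dilate_parts L f E (c c' : R -> R) (r : R) :
  continuous f -> supp_in L f -> radial_profile L E ->
  (forall x : R, is_derive x 1 E (- (2 * pi) * odd_part f x)) ->
  (forall x : R, is_derive x 1 c (2 * pi * c' x)) -> continuous c' ->
  r * integralR (fun t => E t * c' (r * t)) =
  integralR (fun t => f t * c (r * t)) - integralR (fun t => f t * c (- r * t)).
Proof.
move=> cf hf [sE eE hE] dE dc cc'.
have pi2 : 2 * pi != 0 :> R by rewrite mulf_neq0 ?pnatr_eq0 ?gt_eqF ?pi_gt0.
have ccts : continuous c by move=> x; exact: is_derive_continuous (dc x).
have ccE : cc E by split; [exact: rsmooth_cts|exists L].
have ccf : cc f by split => //; exists L.
have dil (h : R -> R) (a : R) : continuous h -> continuous (fun t => h (a * t)).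
  by move=> ch; apply: cts_comp => //; exact: cts_scale.
have cco : cc (fun x => - (2 * pi) * odd_part f x).
  apply: cc_cmul; rewrite /odd_part; apply: cc_add => //.
  by under eq_fun do rewrite -mulN1r; apply: cc_cmul; exact: cc_reflect.
have dC (x : R) : is_derive x 1 (fun t => c (r * t)) (r * (2 * pi * c' (r * x))).
  apply: (is_derive_eq (@is_derive_chain _ c (fun t => r * t) x _ _ (dc _)
    (is_derive_scale r x))).
  by rewrite mulrC.
have cC : continuous (fun x => r * (2 * pi * c' (r * x))).
  by do 2 (apply: cts_mul; first exact: cts_const); exact: dil.
have iE : cc (fun t => E t * c' (r * t)) by apply: cc_mul => //; exact: dil.
have := integral_parts dE dC cco ccE cC.
have -> : integralR (fun x => E x * (r * (2 * pi * c' (r * x)))) =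
    2 * pi * (r * integralR (fun t => E t * c' (r * t))).
  rewrite -!integralZ //; last exact: cc_cmul.
  by apply: integral_eq => t; ring.
have i1 : cc (fun t => f t * c (r * t)) by apply: cc_mul => //; exact: dil.
have i2 : cc (fun t => f t * c (- r * t)) by apply: cc_mul => //; exact: dil.
have -> : integralR (fun x => - (2 * pi) * odd_part f x * c (r * x)) =
    - (2 * pi) * (integralR (fun t => f t * c (r * t)) -
      integralR (fun t => f t * c (- r * t))).
  have i3 : cc (fun t => -1 * (f (- t) * c (- r * - t))).
    exact/cc_cmul/(cc_reflect i2).
  have -> : - integralR (fun t => f t * c (- r * t)) =
      integralR (fun t => -1 * (f (- t) * c (- r * - t))).
    rewrite integralZ; last exact: cc_reflect i2.
    by rewrite mulN1r (integral_reflect i2).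
  rewrite -integralD // -integralZ; last exact: cc_add.
  by apply: integral_eq => t; rewrite /odd_part mulrNN; ring.
move=> /esym /eqP; rewrite eqr_oppLR mulNr opprK => /eqP e.
by apply: (mulfI pi2); rewrite e.
Qed.

(** The profile of a trigonometric integral of f is a trigonometric integral of E.
    At the origin, where the profile is a derivative, this follows from the
    continuity of the right-hand side. *)
Lemma profile_fourier L f1 f2 E1 E2 (c d c' d' : R -> R) :
  continuous f1 -> supp_in L f1 -> radial_profile L E1 ->
  (forall x : R, is_derive x 1 E1 (- (2 * pi) * odd_part f1 x)) ->
  continuous f2 -> supp_in L f2 -> radial_profile L E2 ->
  (forall x : R, is_derive x 1 E2 (- (2 * pi) * odd_part f2 x)) ->
  (forall x : R, is_derive x 1 c (2 * pi * c' x)) -> continuous c' ->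
  (forall x : R, is_derive x 1 d (2 * pi * d' x)) -> continuous d' ->
  profile (fun r => integralR (fun t => f1 t * c (r * t) + f2 t * d (r * t))) =
  (fun r => integralR (fun t => E1 t * c' (r * t) + E2 t * d' (r * t))).
Proof.
move=> cf1 hf1 rE1 dE1 cf2 hf2 rE2 dE2 dc cc' dd cd'.
have ccts : continuous c by move=> x; exact: is_derive_continuous (dc x).
have dcts : continuous d by move=> x; exact: is_derive_continuous (dd x).
have [[sE1 _ hE1] [sE2 _ hE2]] := (rE1, rE2).
have cm (f h : R -> R) (r : R) : continuous f -> supp_in L f -> continuous h ->
    cc (fun t => f t * h (r * t)).
  move=> cf hf ch; apply: cc_mul; first by split => //; exists L.
  by apply: cts_comp => //; exact: cts_scale.
set F := fun r => integralR _; set B := fun r => integralR _.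
have BE : B = fun r => integralR (fun t => E1 t * c' (r * t)) +
    integralR (fun t => E2 t * d' (r * t)).
  by apply/funext => r; apply: integralD; apply: cm => //; exact: rsmooth_cts.
have FE r : F r = integralR (fun t => f1 t * c (r * t)) +
    integralR (fun t => f2 t * d (r * t)).
  by apply: integralD; exact: cm.
have cB : continuous B.
  by rewrite BE; apply: cts_add; apply: integral_dilate_cts => //;
    (exact: rsmooth_cts || eassumption).
have oF r : odd_part F r = r * B r.
  rewrite /odd_part !FE BE mulrDr.
  rewrite (integral_dilate_parts r cf1 hf1 rE1 dE1 dc cc').
  rewrite (integral_dilate_parts r cf2 hf2 rE2 dE2 dd cd'); ring.
have -> : profile F = quot (fun r => r * B r).
  by rewrite /profile; congr quot; exact/funext.
apply/funext => r; rewrite /quot; case: eqP => [->|/eqP r0]; last by rewrite mulrC mulKf.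
apply: is_derive_derive1; apply: cvg_is_derive.
apply: (@cvg_trans _ (B @ 0^')); last exact: cvg_within_filter (cB 0).
apply: near_eq_cvg; near=> h.
rewrite addr0 mul0r subr0 mulKf //.
by near: h; exact: nbhs_dnbhs_neq.
Unshelve. all: by end_near. Qed.

End Walk.

(** * Radial functions on Euclidean space *)

Section RadialOperators.
Context {R : realType} (k : nat).
Local Notation V := 'rV[R]_k.
Implicit Types (E : R -> R) (x v w : V) (A B : (R -> R) -> V -> R).

Lemma dotvC x v : dotv x v = dotv v x.
Proof. by apply: eq_bigr => i _; rewrite mulrC. Qed.

Lemma dotvDl x v w : dotv (x + v) w = dotv x w + dotv v w.
Proof. by rewrite /dotv -big_split; apply: eq_bigr => i _; rewrite !mxE mulrDl. Qed.

Lemma dotvZl (c : R) x w : dotv (c *: x) w = c * dotv x w.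
Proof. by rewrite /dotv mulr_sumr; apply: eq_bigr => i _; rewrite !mxE mulrA. Qed.

Lemma dotv_line x v (t : R) :
  dotv (t *: v + x) (t *: v + x) = dotv x x + 2 * dotv x v * t + dotv v v * t ^+ 2.
Proof.
rewrite dotvDl dotvZl [dotv v _]dotvC [dotv x _]dotvC !dotvDl !dotvZl.
by rewrite [dotv v x]dotvC; ring.
Qed.

Lemma coord_le_enorm x i : `|x ord0 i| <= enorm x.
Proof.
rewrite -sqrtr_sqr ler_sqrt ?dotv_ge0 //.
rewrite /dotv (bigD1 i) //= -expr2 lerDl; apply: sumr_ge0 => j _.
by rewrite -expr2 sqr_ge0.
Qed.

Lemma norm_le_enorm x : `|x| <= enorm x.
Proof.
rewrite /Num.norm /= mx_normrE; apply/bigmax_leP; split; first exact: sqrtr_ge0.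
by move=> [i j] _ /=; rewrite (ord1 i); exact: coord_le_enorm.
Qed.

Lemma dotv_le x w : `|dotv x w| <= enorm x * \sum_i `|w ord0 i|.
Proof.
apply: (le_trans (ler_norm_sum _ _ _)); rewrite mulr_sumr; apply: ler_sum => i _.
by rewrite normrM ler_wpM2r // coord_le_enorm.
Qed.

Lemma dotv_cts w : continuous (fun x : V => dotv x w).
Proof.
rewrite /dotv; elim: (index_enum _) => [|i s ih].
  by under eq_fun do rewrite big_nil; exact: cts_const.
under eq_fun do rewrite big_cons; apply: cts_add => //.
by apply: cts_mul; [exact: coord_continuous|exact: cts_const].
Qed.

Lemma enorm_cts : continuous (@enorm R k).
Proof.
apply: (@cts_comp _ _ (fun x : V => dotv x x)); last exact: sqrt_continuous.
rewrite /dotv; elim: (index_enum _) => [|i s ih].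
  by under eq_fun do rewrite big_nil; exact: cts_const.
under eq_fun do rewrite big_cons; apply: cts_add => //.
by apply: cts_mul; exact: coord_continuous.
Qed.

Lemma is_derive_line (f : V -> R) x v (a : R) :
  is_derive (0 : R) 1 (fun t : R => f (t *: v + x)) a -> is_derive x v f a.
Proof.
move=> h; have := is_derive_cvg h.
have -> : (fun t : R => t^-1 * (f ((t + 0) *: v + x) - f (0 *: v + x))) =
    (fun t : R => t^-1 *: ((f \o shift x) (t *: v) - f x)).
  by apply/funext => t; rewrite addr0 scale0r add0r.
by move=> c; split; [apply/cvg_ex; exists a|exact: (cvg_lim _ c)].
Qed.

Lemma is_derive_dotv x v w : is_derive x v (fun y : V => dotv y w) (dotv v w).
Proof.
apply: is_derive_line.
have -> : (fun t : R => dotv (t *: v + x) w) = (fun t => dotv v w * t + dotv x w).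
  by apply/funext => t; rewrite dotvDl dotvZl mulrC.
apply: (is_derive_eq (is_derive_add (is_derive_scale (dotv v w) 0)
  (is_derive_const (dotv x w) (0 : R) 1))).
by rewrite addr0.
Qed.

Lemma is_derive_enorm E x v : rsmooth E -> evenf E ->
  is_derive x v (fun y : V => E (enorm y)) (dotv x v * evendiv E (enorm x)).
Proof.
move=> sE eE; apply: is_derive_line.
pose g (t : R) := dotv x x + 2 * dotv x v * t + dotv v v * t ^+ 2.
have gE t : dotv (t *: v + x) (t *: v + x) = g t by exact: dotv_line.
have dg (t : R) : is_derive t 1 g (2 * dotv x v + dotv v v * (2 * t)).
  apply: (is_derive_eq (is_derive_add (is_derive_add (is_derive_const _ t 1)
    (is_derive_scale (2 * dotv x v) t)) (is_derive_cmul (dotv v v) (is_derive_sq t)))).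
  by rewrite add0r.
have g0 t : 0 <= g t by rewrite -gE dotv_ge0.
have -> : (fun t : R => E (enorm (t *: v + x))) = (fun t => E (Num.sqrt (g t))).
  by apply/funext => t; rewrite /enorm gE.
apply: (is_derive_eq (is_derive_radius sE eE g0
  (fun t => let: DeriveDef d _ := dg t in d) (dg 0))).
rewrite !mulr0 addr0 [2 * _]mulrC mulfK ?pnatr_eq0 //; congr (_ * evendiv E _).
by rewrite /enorm /g mulr0 expr0n /= mulr0 !addr0.
Qed.

(** The differential operators that produce the derivatives of E (|x|) from E.
    They form a class closed under directional derivatives, which gives smoothness
    of radial functions and, at once, estimates that are uniform in E. *)
Inductive rop : ((R -> R) -> V -> R) -> Prop :=
| rop_zero : rop (fun _ _ => 0)
| rop_radial j : rop (fun E x => iter j evendiv E (enorm x))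
| rop_scale c A : rop A -> rop (fun E x => c * A E x)
| rop_dot w A : rop A -> rop (fun E x => dotv x w * A E x)
| rop_add A B : rop A -> rop B -> rop (fun E x => A E x + B E x).

Lemma rop_derive A v : rop A -> exists2 B, rop B &
  forall E, rsmooth E -> evenf E -> forall x, is_derive x v (A E) (B E x).
Proof.
elim=> [|j|c A' _ [B rB dB]|w A' rA [B rB dB]|A1 A2 _ [B1 r1 d1] _ [B2 r2 d2]].
- by exists (fun _ _ => 0); [exact: rop_zero|move=> E _ _ x; exact: is_derive_const].
- exists (fun E x => dotv x v * iter j.+1 evendiv E (enorm x)).
    exact: (rop_dot v (rop_radial j.+1)).
  move=> E sE eE x; have [sj ej] := rsmooth_iter_evendiv j sE eE.
  exact: is_derive_enorm.
- exists (fun E x => c * B E x); first exact: rop_scale.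
  by move=> E sE eE x; apply: is_derive_cmul; exact: dB.
- exists (fun E x => dotv v w * A' E x + dotv x w * B E x).
    by apply: rop_add; [exact: rop_scale|exact: rop_dot].
  by move=> E sE eE x; apply: is_derive_mul; [exact: is_derive_dotv|exact: dB].
- exists (fun E x => B1 E x + B2 E x); first exact: rop_add.
  by move=> E sE eE x; apply: is_derive_add; [exact: d1|exact: d2].
Qed.

Lemma rop_cts A : rop A -> forall E, rsmooth E -> evenf E -> continuous (A E).
Proof.
elim=> [|j|c A' _ ih|w A' _ ih|A1 A2 _ ih1 _ ih2] E sE eE.
- exact: cts_const.
- have [sj _] := rsmooth_iter_evendiv j sE eE.
  by apply: cts_comp; [exact: enorm_cts|exact: rsmooth_cts].
- by apply: cts_mul; [exact: cts_const|exact: ih].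
- by apply: cts_mul; [exact: dotv_cts|exact: ih].
- by apply: cts_add; [exact: ih1|exact: ih2].
Qed.

Lemma bnd_iter_evendiv j N : exists N' C, 0 <= C /\
  forall E M, rsmooth E -> evenf E -> bnd E N' M -> bnd (iter j evendiv E) N (C * M).
Proof.
elim: j N => [|j ih] N.
  by exists N, 1; split => // E M _ _; rewrite mul1r.
have [N' [C [C0 h]]] := ih N.+2; exists N', ((N.+1)`!%:R * C); split.
  exact: mulr_ge0.
move=> E M sE eE bE; have [sj ej] := rsmooth_iter_evendiv j sE eE.
rewrite -mulrA; apply: bnd_quot; first exact: rsmooth_derive.
  exact/oddf0/oddf_derive.
exact/bnd_derive/h.
Qed.

Lemma rop_bound A m : rop A -> exists N C, 0 <= C /\
  forall E M, rsmooth E -> evenf E -> bnd E N M ->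
    forall x, enorm x ^+ m * `|A E x| <= C * M.
Proof.
have en0 x : 0 <= enorm x := sqrtr_ge0 _.
move=> rA; elim: rA m => [|j|c A' _ ih|w A' _ ih|A1 A2 _ ih1 _ ih2] m.
- exists 0%N, 0; split => // E M _ _ _ x; by rewrite normr0 mulr0 mul0r.
- have [N [C [C0 h]]] := bnd_iter_evendiv j m; exists N, C; split => // E M sE eE bE x.
  have := h E M sE eE bE m 0%N (leqnn m) (leq0n m) (enorm x).
  by rewrite ger0_norm.
- have [N [C [C0 h]]] := ih m; exists N, (`|c| * C); split; first exact: mulr_ge0.
  move=> E M sE eE bE x; rewrite normrM mulrCA -mulrA ler_wpM2l //; exact: h.
- have [N [C [C0 h]]] := ih m.+1; pose K := \sum_i `|w ord0 i|.
  have K0 : 0 <= K by exact: sumr_ge0.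
  exists N, (K * C); split; first exact: mulr_ge0.
  move=> E M sE eE bE x; rewrite normrM mulrA.
  apply: (@le_trans _ _ (K * (enorm x ^+ m.+1 * `|A' E x|))).
    rewrite mulrA ler_wpM2r // exprSr mulrCA ler_wpM2l ?exprn_ge0 //.
    by rewrite mulrC; exact: dotv_le.
  by rewrite -mulrA ler_wpM2l //; exact: h.
- have [N1 [C1 [C10 h1]]] := ih1 m; have [N2 [C2 [C20 h2]]] := ih2 m.
  exists (maxn N1 N2), (C1 + C2); split; first exact: addr_ge0.
  move=> E M sE eE bE x; rewrite mulrDl.
  apply: (@le_trans _ _ (enorm x ^+ m * (`|A1 E x| + `|A2 E x|))).
    by rewrite ler_wpM2l ?exprn_ge0 // ler_normD.
  rewrite mulrDr; apply: lerD.
    by apply: h1 => //; exact: bnd_le (leq_maxl _ _) bE.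
  by apply: h2 => //; exact: bnd_le (leq_maxr _ _) bE.
Qed.

End RadialOperators.

(** * Smooth, Schwartz and test functions through their real and imaginary parts *)

Section RealParts.
Context {R : realType} {V : normedModType R}.
Implicit Types (f : V -> R[i]) (g : V -> R).

Definition iter_derive (vs : seq V) g : V -> R :=
  foldr (fun v h => (fun x => 'D_v h x)) g vs.

Definition vsmooth g := forall vs, continuous (iter_derive vs g) /\
  forall x v, derivable (iter_derive vs g) x v.

Definition re f : V -> R := fun x => complex.Re (f x).
Definition im f : V -> R := fun x => complex.Im (f x).

Lemma iter_cderiveE vs f : iter_cderive vs f =
  fun x => iter_derive vs (re f) x +i* iter_derive vs (im f) x.
Proof.
elim: vs => [|v vs ih]; first by apply/funext => x; rewrite /= /re /im; case: (f x).
by rewrite /= ih.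
Qed.

Lemma smoothP f : smooth f <-> vsmooth (re f) /\ vsmooth (im f).
Proof.
split=> [h|[h1 h2] vs].
  split=> vs; have [c1 c2 d] := h vs; move: c1 c2 d; rewrite iter_cderiveE /=.
    by move=> c1 _ d; split => // x v; exact: (d x v).1.
  by move=> _ c2 d; split => // x v; exact: (d x v).2.
rewrite iter_cderiveE /=; have [c1 d1] := h1 vs; have [c2 d2] := h2 vs.
by split.
Qed.

Lemma normC_re (z : R[i]) : `|complex.Re z| <= normC z.
Proof.
case: z => a b; rewrite /normC /= -sqrtr_sqr ler_sqrt ?lerDl ?sqr_ge0 //.
by rewrite addr_ge0 ?sqr_ge0.
Qed.

Lemma normC_im (z : R[i]) : `|complex.Im z| <= normC z.
Proof.
case: z => a b; rewrite /normC /= -sqrtr_sqr ler_sqrt ?lerDr ?sqr_ge0 //.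
by rewrite addr_ge0 ?sqr_ge0.
Qed.

Lemma normC_le (z : R[i]) : normC z <= `|complex.Re z| + `|complex.Im z|.
Proof.
case: z => a b; rewrite /normC /=.
rewrite -[leRHS]ger0_norm ?addr_ge0 // -sqrtr_sqr ler_sqrt ?sqr_ge0 //.
rewrite sqrrD !real_normK ?num_real // addrAC lerDl.
by rewrite mulrn_wge0 // mulr_ge0.
Qed.

Lemma normC_ge0 (z : R[i]) : 0 <= normC z.
Proof. exact: le_trans (normr_ge0 _) (normC_re z). Qed.

Lemma seminorm_ub m vs f : schwartz f ->
  forall x, `|x| ^+ m * normC (iter_cderive vs f x) <= seminorm m vs f.
Proof.
move=> [_ /(_ m vs) [M hM]] x; apply: ub_le_sup; last by exists x.
by exists M => _ [y _ <-].
Qed.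

Lemma seminorm_ge0 m vs f : schwartz f -> 0 <= seminorm m vs f.
Proof.
move=> sf; apply: (le_trans _ (seminorm_ub m vs sf 0)).
by rewrite mulr_ge0 ?exprn_ge0 ?normC_ge0.
Qed.

Lemma seminorm_le m vs f (B : R) :
  (forall x, `|x| ^+ m * normC (iter_cderive vs f x) <= B) -> seminorm m vs f <= B.
Proof.
move=> h; apply: ge_sup; last by move=> _ [x _ <-].
by exists (`|0 : V| ^+ m * normC (iter_cderive vs f 0)), 0.
Qed.

Lemma test_bounded f : test_fun f -> exists2 L, 0 < L & forall x, L < `|x| -> f x = 0.
Proof.
move=> [_ /compact_bounded [M [_ hM]]].
exists (`|M| + 1) => [|x hx]; first by rewrite ltr_wpDl.
apply/eqP/negPn/negP => fx; have Mlt : M < `|M| + 1 by have := ler_norm M; lra.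
have := hM _ Mlt x (@subset_closure _ [set x | f x != 0] x fx).
by rewrite /= leNgt hx.
Qed.

End RealParts.

Section OneVariable.
Context {R : realType}.
Implicit Types (g : R -> R) (f : R -> R[i]).

Lemma is_derive_dir g (x v a : R) : is_derive x 1 g a -> is_derive x v g (v * a).
Proof.
move=> dg; have df : differentiable g x by apply/derivable1_diffP; case: dg.
split; first exact: diff_derivable.
have d1 : derivable g x 1 by case: dg.
rewrite (deriveE v df) (deriv1E d1) /GRing.scale /=.
by rewrite (is_derive_derive1 dg).
Qed.

Lemma iter_deriveE vs g : rsmooth g ->
  iter_derive vs g = fun x => (\prod_(v <- vs) v) * g^`(size vs) x.
Proof.
move=> sg; elim: vs => [|v vs ih].
  by apply/funext => x; rewrite big_nil mul1r.
apply/funext => x; rewrite /= ih big_cons.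
have h := is_derive_dir v (is_derive_cmul (\prod_(v <- vs) v)
  (rsmooth_tower sg (size vs) x)).
by rewrite (@derive_val _ _ _ _ _ _ _ h) mulrA.
Qed.

Lemma vsmooth_derive1n n g : vsmooth g -> iter_derive (nseq n (1 : R)) g = g^`(n).
Proof.
move=> sg; elim: n => [//|n ih]; rewrite derive1nS /= ih.
by apply/funext => x; rewrite derive1E.
Qed.

Lemma vsmooth_rsmooth g : vsmooth g -> rsmooth g.
Proof. by move=> sg n x; rewrite -(vsmooth_derive1n n sg); exact: (sg _).2. Qed.

Lemma schwartz_rsmooth f : schwartz f -> rsmooth (re f) /\ rsmooth (im f).
Proof. by move=> [/smoothP [s1 s2] _]; split; exact: vsmooth_rsmooth. Qed.

Definition seminorms_upto (N : nat) : seq (nat * seq R) :=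
  [seq (n, nseq j (1 : R)) | n <- iota 0 N.+1, j <- iota 0 N.+1].

Lemma schwartz_bnd f N : schwartz f ->
  bnd (re f) N (\sum_(p <- seminorms_upto N) seminorm p.1 p.2 f) /\
  bnd (im f) N (\sum_(p <- seminorms_upto N) seminorm p.1 p.2 f).
Proof.
move=> sf; have [/smoothP [s1 s2] _] := sf.
have key n j r : (n <= N)%N -> (j <= N)%N ->
    `|r| ^+ n * normC (iter_cderive (nseq j (1 : R)) f r) <=
    \sum_(p <- seminorms_upto N) seminorm p.1 p.2 f.
  move=> nN jN; apply: (le_trans (seminorm_ub n (nseq j (1 : R)) sf r)).
  have : (n, nseq j (1 : R)) \in seminorms_upto N.
    by apply/allpairsP; exists (n, j); rewrite !mem_iota !add0n !ltnS.
  elim: (seminorms_upto N) => [//|p s ih]; rewrite in_cons big_cons.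
  have s0 : 0 <= \sum_(p <- s) seminorm p.1 p.2 f.
    by apply: sumr_ge0 => q _; exact: seminorm_ge0.
  case/orP => [/eqP <-|/ih h]; first by rewrite lerDl.
  by apply: (le_trans h); rewrite lerDr seminorm_ge0.
split=> n j nN jN r; apply: le_trans (key n j r nN jN); rewrite ler_wpM2l ?exprn_ge0 //;
  rewrite iter_cderiveE !vsmooth_derive1n //.
  exact: (normC_re (_ +i* _)).
exact: (normC_im (_ +i* _)).
Qed.

Lemma test_schwartz f : test_fun f -> schwartz f.
Proof.
move=> tf; have [sf _] := tf; split=> // m vs.
have [L L0 hL] := test_bounded tf; have [/vsmooth_rsmooth s1 /vsmooth_rsmooth s2] :=
  (smoothP f).1 sf.
rewrite iter_cderiveE !iter_deriveE //.
have b g : rsmooth g -> supp_in L g -> exists M, forall x : R,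
    `|x| ^+ m * `|(\prod_(v <- vs) v) * g^`(size vs) x| <= M.
  move=> sg hg; pose h x := `|x| ^+ m * `|(\prod_(v <- vs) v) * g^`(size vs) x|.
  have LL : - L <= L by lra.
  have ch : continuous h.
    apply: cts_mul.
      apply: (@cts_comp _ _ _ (fun y => y ^+ m)); last exact: exprn_continuous.
      exact/cts_norm/cts_id.
    by apply/cts_norm/cts_mul; [exact: cts_const|exact: rsmooth_ctsn].
  have [M M0 hM] := continuous_bounded_itv LL ch; exists M => x.
  have [xL|xL] := leP `|x| L.
    by apply: (le_trans (ler_norm _)); apply: hM; rewrite -ler_norml.
  suff -> : g^`(size vs) x = 0 by rewrite mulr0 normr0 mulr0.
  have sn n : supp_in L g^`(n) by elim: n => [//|n ih]; exact: supp_in_derive.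
  exact: sn.
have [M1 h1] := b _ s1 (fun x hx => congr1 (@complex.Re R) (hL x hx)).
have [M2 h2] := b _ s2 (fun x hx => congr1 (@complex.Im R) (hL x hx)).
exists (M1 + M2) => x; apply: le_trans (lerD (h1 x) (h2 x)).
by rewrite -mulrDr ler_wpM2l ?exprn_ge0 //; exact: (normC_le (_ +i* _)).
Qed.

End OneVariable.

(** * Radial lifts of functions on the line *)

Section Radial.
Context {R : realType} (k : nat).
Local Notation V := 'rV[R]_k.
Implicit Types (E : R -> R) (f : R -> R[i]).

Definition radial (E1 E2 : R -> R) : V -> R[i] :=
  fun x => E1 (enorm x) +i* E2 (enorm x).

Lemma iter_derive_radial (vs : seq V) : exists2 A, rop A &
  forall E, rsmooth E -> evenf E -> iter_derive vs (fun x => E (enorm x)) = A E.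
Proof.
elim: vs => [|v vs [A rA hA]].
  by exists (fun E x => iter 0 evendiv E (enorm x)); first exact: (rop_radial k 0).
have [B rB hB] := rop_derive v rA; exists B => // E sE eE.
apply/funext => x; rewrite /= (hA E sE eE).
exact: (@derive_val _ _ _ _ _ _ _ (hB E sE eE x)).
Qed.

Lemma radial_vsmooth E : rsmooth E -> evenf E -> vsmooth (fun x : V => E (enorm x)).
Proof.
move=> sE eE vs; have [A rA hA] := iter_derive_radial vs; rewrite hA //.
split; first exact: rop_cts.
move=> x v; have [B _ hB] := rop_derive v rA.
by have [] := hB E sE eE x.
Qed.

Lemma radial_smooth E1 E2 : rsmooth E1 -> evenf E1 -> rsmooth E2 -> evenf E2 ->
  smooth (radial E1 E2).
Proof. by move=> *; apply/smoothP; split; exact: radial_vsmooth. Qed.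

Lemma radial_bound m (vs : seq V) : exists N C, 0 <= C /\
  forall E1 E2 M, rsmooth E1 -> evenf E1 -> rsmooth E2 -> evenf E2 ->
    bnd E1 N M -> bnd E2 N M ->
    forall x, `|x| ^+ m * normC (iter_cderive vs (radial E1 E2) x) <= C * M.
Proof.
have [A rA hA] := iter_derive_radial vs; have [N [C [C0 hC]]] := rop_bound m rA.
exists N, (2 * C); split; first exact: mulr_ge0.
move=> E1 E2 M s1 e1 s2 e2 b1 b2 x; rewrite iter_cderiveE.
have -> : iter_derive vs (re (radial E1 E2)) x = A E1 x by rewrite -hA.
have -> : iter_derive vs (im (radial E1 E2)) x = A E2 x by rewrite -hA.
have nn := norm_le_enorm x.
apply: (@le_trans _ _ (enorm x ^+ m * (`|A E1 x| + `|A E2 x|))).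
  apply: ler_pM; [exact: exprn_ge0|exact: normC_ge0| |exact: (normC_le (_ +i* _))].
  by apply: lerXn2r; rewrite // nnegrE ?sqrtr_ge0.
rewrite mulrDr -mulrA mulrDl mul1r; apply: lerD; exact: hC.
Qed.

Lemma radial_test L E1 E2 : radial_profile L E1 -> radial_profile L E2 ->
  test_fun (radial E1 E2).
Proof.
move=> [s1 e1 h1] [s2 e2 h2]; split; first exact: radial_smooth.
apply: bounded_closed_compact; last exact: closed_closure.
exists L; split; first exact: num_real.
move=> M LM x cx.
suff : closed [set y : V | `|y| <= M].
  move=> /closure_id ->; apply: closure_subset cx => y /= fy.
  have [yL|yL] := leP (enorm y) L.
    by apply: (le_trans (norm_le_enorm y)); exact: (le_trans yL (ltW LM)).
  move: fy; rewrite /radial h1 ?h2 ?ger0_norm ?sqrtr_ge0 //.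
  by rewrite eqxx.
apply: (@closed_comp _ _ (fun y : V => `|y|) [set r | r <= M]); last exact: closed_le.
by move=> y _; exact: norm_continuous.
Qed.

(** The radial function on R^k attached to f, (f (|x|) - f (- |x|)) / |x|. *)
Definition lift f : V -> R[i] := radial (profile (re f)) (profile (im f)).

Lemma lift_smooth f : schwartz f -> smooth (lift f).
Proof.
move=> /schwartz_rsmooth [s1 s2].
by apply: radial_smooth; (exact: rsmooth_profile || exact: evenf_profile).
Qed.

Lemma lift_bound m (vs : seq V) : exists N C, 0 <= C /\
  forall f, schwartz f -> forall x,
    `|x| ^+ m * normC (iter_cderive vs (lift f) x) <=
    C * \sum_(p <- seminorms_upto N) seminorm p.1 p.2 f.
Proof.
have [N [C [C0 hC]]] := radial_bound m vs.
exists N.+1, (C * ((N.+1)`!%:R * 2)); split; first by rewrite !mulr_ge0.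
move=> f sf x; have [s1 s2] := schwartz_rsmooth sf.
have [b1 b2] := schwartz_bnd N.+1 sf.
have bp g M : rsmooth g -> bnd g N.+1 M -> bnd (profile g) N ((N.+1)`!%:R * (2 * M)).
  move=> sg bg; apply: bnd_quot; [exact: rsmooth_odd_part| |exact: bnd_odd_part].
  exact/oddf0/oddf_odd_part.
rewrite -!mulrA; apply: hC; by [exact: rsmooth_profile|exact: evenf_profile|exact: bp].
Qed.

Lemma lift_schwartz f : schwartz f -> schwartz (lift f).
Proof.
move=> sf; split; first exact: lift_smooth.
move=> m vs; have [N [C [_ hC]]] := lift_bound m vs.
by eexists; exact: hC.
Qed.

Lemma profile_supp L (g : R -> R) : 0 <= L -> rsmooth g -> supp_in L g ->
  radial_profile L (profile g).
Proof.
move=> L0 sg hg; split; [exact: rsmooth_profile|exact: evenf_profile|].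
apply: supp_in_quot => // x hx; by rewrite /odd_part !hg ?normrN // subr0.
Qed.

Lemma test_parts f : test_fun f -> exists2 L, 0 < L &
  [/\ rsmooth (re f), supp_in L (re f), rsmooth (im f) & supp_in L (im f)].
Proof.
move=> tf; have [L L0 h] := test_bounded tf.
have [/vsmooth_rsmooth s1 /vsmooth_rsmooth s2] := (smoothP f).1 tf.1.
by exists L => //; split=> // x hx; rewrite /re /im h.
Qed.

Lemma lift_test f : test_fun f -> test_fun (lift f).
Proof.
move=> /test_parts [L /ltW L0 [s1 h1 s2 h2]].
by apply: (@radial_test L); exact: profile_supp.
Qed.

Lemma complex_div_real (a b c : R) : (a +i* b) / c%:C = (a / c) +i* (b / c).
Proof.
rewrite -fmorphV; apply/eqP; rewrite eq_complex /= !mulr0 subr0 add0r.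
by rewrite !eqxx.
Qed.

Lemma lift_neq0 f x : x != 0 ->
  lift f x = (f (enorm x) - f (- enorm x)) / (enorm x)%:C.
Proof.
move=> x0; have r0 : enorm x != 0.
  apply: contra x0 => /eqP r0; apply/eqP/rowP => i; rewrite mxE.
  apply/eqP; rewrite -normr_le0 -r0; exact: coord_le_enorm.
rewrite /lift /radial /profile /quot (negbTE r0) /odd_part /re /im.
case: (f (enorm x)) => a b; case: (f (- enorm x)) => c d.
by rewrite -complex_div_real.
Qed.

Lemma profile_linear (a b : R) (p q h : R -> R) :
  rsmooth p -> rsmooth q -> rsmooth h ->
  profile (fun r => a * p r + b * q r + h r) =
  fun r => a * profile p r + b * profile q r + profile h r.
Proof.
move=> sp sq sh; apply/funext => r; rewrite /profile /quot.
have oE : odd_part (fun r => a * p r + b * q r + h r) =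
    fun r => a * odd_part p r + b * odd_part q r + odd_part h r.
  by apply/funext => x; rewrite /odd_part; ring.
rewrite oE; case: eqP => _; last first.
  move: (odd_part p r) (odd_part q r) (odd_part h r) (r^-1) => u v w z; ring.
have so g : rsmooth g -> is_derive (0 : R) 1 (odd_part g) ((odd_part g)^`() 0).
  by move=> sg; apply: rsmooth_is_derive; exact: rsmooth_odd_part.
exact: is_derive_derive1 (is_derive_add (is_derive_add
  (is_derive_cmul a (so _ sp)) (is_derive_cmul b (so _ sq))) (so _ sh)).
Qed.

Lemma re_linear (a b : R) f g :
  re (fun x => (a +i* b) * f x + g x) = fun r => a * re f r + (- b) * im f r + re g r.
Proof.
apply/funext => r; rewrite /re /im; case: (f r) (g r) => u v [w z] /=.
by rewrite mulNr.
Qed.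

Lemma im_linear (a b : R) f g :
  im (fun x => (a +i* b) * f x + g x) = fun r => a * im f r + b * re f r + im g r.
Proof. by apply/funext => r; rewrite /re /im; case: (f r) (g r) => u v [w z]. Qed.

Lemma lift_linear (c : R[i]) f g : schwartz f -> schwartz g ->
  lift (fun x => c * f x + g x) = fun x => c * lift f x + lift g x.
Proof.
move=> /schwartz_rsmooth [f1 f2] /schwartz_rsmooth [g1 g2].
case: c => a b; apply/funext => x; rewrite /lift re_linear im_linear.
have -> := profile_linear a (- b) f1 f2 g1.
have -> := profile_linear a b f2 f1 g2.
by rewrite /radial mulNr.
Qed.

(** The function on R^k whose Fourier transform is the lift of the Fourier
    transform of f; the exchange of real and imaginary parts is the factor -i. *)
Definition walk_lift m f : V -> R[i] :=
  radial (iter m walk (profile (im f))) (fun r => - iter m walk (profile (re f)) r).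

Lemma walk_lift_test m f : test_fun f -> test_fun (walk_lift m f).
Proof.
move=> /test_parts [L /ltW L0 [s1 h1 s2 h2]].
have [r1 r2] := (iter_walk_profile m L0 (profile_supp L0 s1 h1),
                 iter_walk_profile m L0 (profile_supp L0 s2 h2)).
apply: (radial_test r2); case: r1 => sE eE hE.
have -> : (fun r => - iter m walk (profile (re f)) r) =
    (fun r => -1 * iter m walk (profile (re f)) r).
  by apply/funext => r; rewrite mulN1r.
split; first exact: rsmooth_cmul.
  by move=> r; rewrite eE.
by move=> r hr; rewrite hE // mulr0.
Qed.

End Radial.

Arguments lift {R} k f _.
Arguments walk_lift {R} k m f _.

(** * The Fourier transform commutes with lifting *)

Section LiftFourier.
Context {R : realType}.

Let ccos (v : R) := cos (- (2 * pi * v)).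
Let csin (v : R) := sin (- (2 * pi * v)).

Let dlin (v : R) : is_derive v 1 (fun v => - (2 * pi * v)) (- (2 * pi)).
Proof.
have -> : (fun v : R => - (2 * pi * v)) = (fun v => - (2 * pi) * v).
  by apply/funext => x; rewrite mulNr.
exact: is_derive_scale.
Qed.

Let dcos (v : R) : is_derive v 1 ccos (2 * pi * csin v).
Proof.
by apply: (is_derive_eq (is_derive_chain (is_derive_cos _) (dlin v))); rewrite mulrNN mulrC.
Qed.

Let dsin (v : R) : is_derive v 1 csin (2 * pi * - ccos v).
Proof.
apply: (is_derive_eq (is_derive_chain (is_derive_sin _) (dlin v))).
by rewrite mulrN mulrN mulrC.
Qed.

Let ccts : continuous ccos.
Proof. by move=> v; exact: is_derive_continuous (dcos v). Qed.

Let scts : continuous csin.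
Proof. by move=> v; exact: is_derive_continuous (dsin v). Qed.

Let oppcts (h : R -> R) : continuous h -> continuous (fun v => - h v).
Proof. by move=> ch v; apply: cvgN; exact: ch. Qed.

Let dopp (h h' : R -> R) : (forall v : R, is_derive v 1 h (2 * pi * h' v)) ->
  forall v : R, is_derive v 1 (fun v => - h v) (2 * pi * - h' v).
Proof.
by move=> dh v; apply: (is_derive_eq (is_deriveN (dh v))); rewrite mulrN.
Qed.

(** Both sides are reduced to integrals over the line of the primitives E1, E2 whose
    walk starts at the profiles of the real and imaginary parts of f: the left side
    by the dimension walk, the right side by integration by parts. *)
Lemma fourier_lift m (f : R -> R[i]) : test_fun f ->
  fourierk (walk_lift m.+1.*2.+1 m f) = lift m.+1.*2.+1 (fourier1 f).
Proof.
move=> /test_parts [L /ltW L0 [s1 h1 s2 h2]].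
have [E1 [r1 w1 d1]] := profile_primitive L0 s1 h1.
have [E2 [r2 w2 d2]] := profile_primitive L0 s2 h2.
pose p (E : R -> R) (i : nat) (w : R) := iter i walk E (Num.sqrt w).
have chain E : radial_profile L E -> forall i, polar_pair (p E i) (p E i.+1).
  by move=> rE i; exact: walk_polar_pair (iter_walk_profile i L0 rE).
have top E : radial_profile L E -> continuous (p E 0%N) /\
    exists L', vanish_above L' (p E 0%N).
  move=> rE; split; first exact: profile_sqrt_cts rE.
  by eexists; exact: profile_sqrt_vanish rE.
have pE E : radial_profile L E -> forall t, p E 0%N (t ^+ 2) = E t.
  by move=> [_ eE _] t; rewrite /p /= sqrtr_sqr evenf_normr.
apply/funext => xi.
have rad (F1 F2 G1 G2 c1 c2 : R -> R) : radial_profile L F1 -> radial_profile L F2 ->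
    iter m.+1 walk F1 = G1 -> iter m.+1 walk F2 = G2 ->
    continuous c1 -> continuous c2 ->
    integralRk (fun x : 'rV[R]_(m.+1.*2.+1) =>
      G1 (enorm x) * c1 (dotv xi x) + G2 (enorm x) * c2 (dotv xi x)) =
    integralR (fun t => F1 t * c1 (enorm xi * t) + F2 t * c2 (enorm xi * t)).
  move=> rF1 rF2 <- <- cc1 cc2'.
  have [[t1 v1] [t2 v2]] := (top _ rF1, top _ rF2).
  have := integralRk_radial t1 v1 t2 v2 (chain _ rF1) (chain _ rF2) cc1 cc2' (m := m.+1)
    xi (lexx 0).
  move=> e; transitivity (integralRk (fun x : 'rV[R]_(m.+1.*2.+1) =>
      sum2 (p F1 m.+1) c1 (p F2 m.+1) c2 (0 + dotv x x) (dotv xi x))).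
    by apply: integralRk_eq => x; rewrite /sum2 /p add0r.
  rewrite e; apply: integral_eq => t; rewrite /sum2 add0r !pE //.
have [c1 c2] := (rsmooth_cts s1, rsmooth_cts s2).
rewrite /fourierk /walk_lift /lift /radial.
have hre : re (fourier1 f) = fun r =>
    integralR (fun t => re f t * ccos (r * t) + im f t * (- csin (r * t))).
  apply/funext => r; rewrite /re /=; apply: integral_eq => t.
  by rewrite /im /expi; case: (f t) => a b /=; rewrite mulrN.
have him : im (fourier1 f) = fun r =>
    integralR (fun t => re f t * csin (r * t) + im f t * ccos (r * t)).
  apply/funext => r; rewrite /im /=; apply: integral_eq => t.
  by rewrite /re /expi; case: (f t) => a b.
have it1 : iter m.+1 walk E1 = iter m walk (profile (re f)) by rewrite iterSr w1.
have it2 : iter m.+1 walk E2 = iter m walk (profile (im f)) by rewrite iterSr w2.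
rewrite hre (profile_fourier c1 h1 r1 d1 c2 h2 r2 d2 dcos scts (dopp dsin)
  (oppcts (oppcts ccts))).
rewrite him (profile_fourier c1 h1 r1 d1 c2 h2 r2 d2 dsin (oppcts ccts) dcos scts).
rewrite -(rad _ _ _ _ _ _ r1 r2 it1 it2 scts (oppcts (oppcts ccts))).
rewrite -(rad _ _ _ _ _ _ r1 r2 it1 it2 (oppcts ccts) scts).
have alg (u v a b : R) :
    ((v +i* - u) * (a +i* b) = (u * b + v * - - a) +i* (u * - a + v * b))%C.
  by apply/eqP; rewrite eq_complex /=; apply/andP; split; apply/eqP; ring.
move: (iter m walk (profile (re f))) (iter m walk (profile (im f))) => H1 H2.
move=> {hre him rad it1 it2 d1 d2 w1 w2 chain top pE}.
have eA : integralRk (fun x : 'rV[R]_(m.+1.*2.+1) => complex.Re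
      ((H2 (enorm x) +i* - H1 (enorm x)) * expi (- (2 * pi * dotv xi x)))) =
    integralRk (fun x : 'rV[R]_(m.+1.*2.+1) =>
      H1 (enorm x) * csin (dotv xi x) + H2 (enorm x) * - - ccos (dotv xi x)).
  by apply: integralRk_eq => x; rewrite /expi alg.
have eB : integralRk (fun x : 'rV[R]_(m.+1.*2.+1) => complex.Im
      ((H2 (enorm x) +i* - H1 (enorm x)) * expi (- (2 * pi * dotv xi x)))) =
    integralRk (fun x : 'rV[R]_(m.+1.*2.+1) =>
      H1 (enorm x) * - ccos (dotv xi x) + H2 (enorm x) * csin (dotv xi x)).
  by apply: integralRk_eq => x; rewrite /expi alg.
exact: (f_equal2 (@Complex R) eA eB).
Qed.

End LiftFourier.

(** * The coefficients of the iterated walk *)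

Section WalkCoefficients.
Context {R : realType}.

(** The coefficients of (- (1 / r) d/dr)^m (o (r) / r), before the normalisation by
    powers of 2 pi. *)
Fixpoint walk_coef (m j : nat) : R :=
  if m is m'.+1 then
    (m'.*2.+1 - j)%:R * walk_coef m' j - (if j is j'.+1 then walk_coef m' j' else 0)
  else (j == 0%N)%:R.

Lemma walk_coef_gt m j : (m < j)%N -> walk_coef m j = 0.
Proof.
elim: m j => [|m ih] [|j] //= mj.
by rewrite ih ?(ltnW mj) // ih // mulr0 subr0.
Qed.

(** Closed form of the recursion, indexed by n = m - j so that no subtraction of
    natural numbers occurs. *)
Lemma walk_coefE n j :
  walk_coef (n + j) j * (j`! * dfact n.*2)%:R = (-1) ^+ j * (n.*2 + j)`!%:R.
Proof.
have [m] : exists m, m = (n + j)%N by exists (n + j)%N.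
elim: m n j => [|m ih] n j.
  by case: n j => [|n] [|j] // _; rewrite /= expr0 mul1r.
case: n j => [|n] [|j] //.
- rewrite add0n => -[mj]; subst m.
  have := ih 0%N j erefl; rewrite add0n muln1 => e.
  have -> : walk_coef j.+1 j.+1 = - walk_coef j j.
    by rewrite /= walk_coef_gt // mulr0 sub0r.
  by rewrite muln1 factS natrM mulNr mulrCA e exprS; ring.
- rewrite addn0 => -[mn]; subst m.
  have e : walk_coef n 0 * (dfact n.*2)%:R = (n.*2)`!%:R.
    by have := ih n 0%N; rewrite !addn0 fact0 mul1n expr0 mul1r; apply.
  have -> : walk_coef n.+1 0 = n.*2.+1%:R * walk_coef n 0 by rewrite /= subn0 subr0.
  rewrite addn0 fact0 mul1n expr0 mul1r doubleS.
  rewrite (_ : dfact n.*2.+2 = (n.*2.+2 * dfact n.*2)%N) // !factS !natrM -e.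
  ring.
- move=> [mn]; have nj : m = (n.+1 + j)%N by rewrite mn addSnnS.
  rewrite (_ : (n.+1 + j.+1)%N = m.+1); last by rewrite mn.
  have e1 := ih n j.+1 mn; have e2 := ih n.+1 j nj; rewrite -mn in e1; rewrite -nj in e2.
  have -> : walk_coef m.+1 j.+1 =
      (n.*2 + j.+1).+1%:R * walk_coef m j.+1 - walk_coef m j.
    by rewrite /=; congr (_%:R * _ - _); rewrite mn -!addnn; lia.
  have hD : (j.+1`! * dfact n.+1.*2 = n.*2.+2 * (j.+1`! * dfact n.*2))%N.
    by rewrite doubleS mulnCA.
  have hD' : (j.+1`! * dfact n.+1.*2 = j.+1 * (j`! * dfact n.+1.*2))%N.
    by rewrite factS mulnA.
  rewrite mulrBl {1}hD hD' (natrM _ n.*2.+2) (natrM _ j.+1 (_ * _)).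
  transitivity ((n.*2 + j.+1).+1%:R * n.*2.+2%:R *
      (walk_coef m j.+1 * (j.+1`! * dfact n.*2)%:R) -
      j.+1%:R * (walk_coef m j * (j`! * dfact n.+1.*2)%:R)); first by ring.
  rewrite e1 e2 (_ : (n.+1.*2 + j)%N = (n.*2 + j.+1).+1); last by rewrite doubleS; lia.
  rewrite (_ : (n.+1.*2 + j.+1)%N = (n.*2 + j.+1).+2); last by rewrite doubleS; lia.
  rewrite !factS !natrM exprS.
  have -> : (n.*2 + j.+1).+2%:R = n.*2.+2%:R + j.+1%:R :> R.
    by rewrite -natrD; congr _%:R; lia.
  ring.
Qed.

(** Differentiating a term o^(j) (r) r^(-n) and dividing by r gives two terms of the
    same shape, whence the recursion that defines walk_coef. *)
Lemma iter_walk_quot m (o : R -> R) : rsmooth o -> forall r, r != 0 ->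
  iter m walk (quot o) r = (2 * pi)^-1 ^+ m *
    \sum_(j < m.+1) walk_coef m j * (o^`(j) r * r^-1 ^+ (m.*2.+1 - j)).
Proof.
move=> so; elim: m => [|m ih] r r0.
  rewrite big_ord_recl big_ord0 /= expr0 !mul1r addr0 expr1.
  by rewrite /quot (negbTE r0).
rewrite iterS /walk /evendiv /quot (negbTE r0).
have dV n : is_derive r 1 (fun y : R => y^-1 ^+ n) (- n%:R * r^-1 ^+ n.+1).
  elim: n => [|n ihn].
    rewrite oppr0 mul0r; have -> : (fun y : R => y^-1 ^+ 0) = (fun=> 1).
      by apply/funext => y; rewrite expr0.
    exact: is_derive_const.
  have -> : (fun y : R => y^-1 ^+ n.+1) = (fun y => y^-1 * y^-1 ^+ n).
    by apply/funext => y; rewrite exprS.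
  apply: (is_derive_eq (is_derive_mul (is_derive_inv r0 (is_derive_idR r)) ihn)).
  by rewrite -exprVn !exprS -[n.+1]addn1 natrD; ring.
pose dS := \sum_(j < m.+1) walk_coef m j * (o^`(j.+1) r * r^-1 ^+ (m.*2.+1 - j) +
  o^`(j) r * (- (m.*2.+1 - j)%:R * r^-1 ^+ (m.*2.+1 - j).+1)).
have dsum : is_derive r 1 (fun y => (2 * pi)^-1 ^+ m *
    \sum_(j < m.+1) walk_coef m j * (o^`(j) y * y^-1 ^+ (m.*2.+1 - j)))
    ((2 * pi)^-1 ^+ m * dS).
  apply: is_derive_cmul; rewrite /dS; elim: (index_enum _) => [|j s ihs].
    by rewrite big_nil; under eq_fun do rewrite big_nil; exact: is_derive_const.
  rewrite big_cons; under eq_fun do rewrite big_cons.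
  apply: is_derive_add => //; apply/is_derive_cmul/is_derive_mul => //.
  exact: (rsmooth_tower so j r).
have near_eq : \forall y \near r, (2 * pi)^-1 ^+ m *
    \sum_(j < m.+1) walk_coef m j * (o^`(j) y * y^-1 ^+ (m.*2.+1 - j)) =
    iter m walk (quot o) y.
  have : \forall y \near r, y != 0.
    have : nbhs r [set y : R | y != 0] by apply: open_nbhs_nbhs; split => //; exact: open_neq.
    by [].
  by apply: filterS => y y0; rewrite ih.
rewrite (is_derive_derive1 (near_eq_is_derive near_eq dsum)) exprS.
rewrite -[RHS]mulrA mulNr -mulrN; congr (_ * _); rewrite -mulrA -mulrN; congr (_ * _).
(* The term with o^(j) in the derivative feeds the coefficients j and j + 1. *)
pose X j : R := o^`(j) r * r^-1 ^+ (m.+1.*2.+1 - j).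
transitivity (\sum_(j < m.+1) ((m.*2.+1 - j)%:R * walk_coef m j * X j) -
    \sum_(j < m.+1) walk_coef m j * X j.+1).
  rewrite /dS mulr_suml -sumrN -sumrB; apply: eq_bigr => j _; rewrite /X.
  have jm : (j <= m)%N by rewrite -ltnS.
  rewrite (_ : (m.+1.*2.+1 - j)%N = (m.*2.+1 - j).+2); last by rewrite doubleS; lia.
  rewrite (_ : (m.+1.*2.+1 - j.+1)%N = (m.*2.+1 - j).+1); last by rewrite doubleS; lia.
  by rewrite !exprS; ring.
transitivity (\sum_(j < m.+2) ((m.*2.+1 - j)%:R * walk_coef m j * X j) -
    \sum_(j < m.+1) walk_coef m j * X j.+1).
  congr (_ - _); rewrite [RHS]big_ord_recr /=.
  by rewrite (walk_coef_gt (ltnSn m)) mulr0 mul0r addr0.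
rewrite big_ord_recl [RHS]big_ord_recl -addrA; congr (_ + _).
  by rewrite /= subr0.
by rewrite -sumrB; apply: eq_bigr => j _; rewrite !lift0 -mulrBl.
Qed.

Lemma beta_coefE m j : (j <= m)%N ->
  beta_coef m.+1.*2.+1 j = (2 * pi : R)^-1 ^+ m * walk_coef m j.
Proof.
move=> jm; have e := walk_coefE (m - j) j; rewrite subnK // in e.
rewrite /beta_coef (_ : (m.+1.*2.+1 - 3)%N = m.*2); last by rewrite doubleS; lia.
rewrite (_ : (m.+1.*2.+1 - j - 3)%N = ((m - j).*2 + j)%N); last by rewrite -!muln2; lia.
rewrite (_ : (m.+1.*2.+1 - 2 * j - 3)%N = (m - j).*2); last by rewrite -!muln2; lia.
have nz : (j`! * dfact (m - j).*2)%:R != 0 :> R.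
  rewrite pnatr_eq0 muln_eq0 negb_or -lt0n fact_gt0 -lt0n /=.
  by elim: (m - j)%N => [//|n ih]; rewrite doubleS /= muln_gt0.
by rewrite divn2 doubleK -natrM -e (mulfK nz) div1r mulrC.
Qed.

End WalkCoefficients.

(** * The measure sigma *)

Section Sigma.
Context {R : realType}.

Lemma enorm_eq0 k (x : 'rV[R]_k) : enorm x = 0 -> x = 0.
Proof.
move=> r0; apply/rowP => i; rewrite mxE; apply/eqP.
by rewrite -normr_le0 -r0; exact: coord_le_enorm.
Qed.

(** Since 0 is not in Lambda, the sums for sigma f and mu (lift f) agree term by
    term. *)
Lemma sigma_lift k (Lambda : set 'rV[R]_k) (a : 'rV[R]_k -> R[i]) (f : R -> R[i]) :
  ~ Lambda 0 -> sigma_measure Lambda a f = discrete_measure Lambda a (lift k f).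
Proof.
move=> L0; apply: eq_fsbigr => l; rewrite inE => Ll; rewrite /delta lift_neq0.
  by rewrite mulrA mulrAC.
by apply/eqP => l0; rewrite l0 in Ll.
Qed.

Lemma sum_complex (n : nat) (c x y : nat -> R) :
  \sum_(0 <= j < n) (c j)%:C * (x j +i* y j) =
  (\sum_(j < n) c j * x j) +i* (\sum_(j < n) c j * y j).
Proof.
rewrite big_mkord; elim: n => [|n ih]; first by rewrite !big_ord0.
rewrite !big_ord_recr /= ih; apply/eqP; rewrite eq_complex /=.
by rewrite !mul0r subr0 addr0 !eqxx.
Qed.

(** The bracket in the formula for the transform of sigma is the expansion of the
    iterated walk at radius |s|. *)
Lemma sigma_fourier_walk_lift m (S : set 'rV[R]_(m.+1.*2.+1))
    (b : 'rV[R]_(m.+1.*2.+1) -> R[i]) (f : R -> R[i]) :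
  ~ S 0 -> smooth f ->
  sigma_fourier S b f = discrete_measure S b (walk_lift m.+1.*2.+1 m f).
Proof.
move=> S0 sf; rewrite /sigma_fourier mulr_fsumr; apply: eq_fsbigr => s.
rewrite inE => Ss; rewrite /delta.
have r0 : enorm s != 0.
  by apply/eqP => /enorm_eq0 s0; rewrite s0 in Ss.
have [/vsmooth_rsmooth s1 /vsmooth_rsmooth s2] := (smoothP f).1 sf.
set r := enorm s in r0 *; set k := m.+1.*2.+1.
have k3 : ((k - 3) %/ 2)%N = m 
  by rewrite (_ : (k - 3)%N = m.*2) ?divn2 ?doubleK //; rewrite /k doubleS; lia.
have k2 : (k - 2)%N = m.*2.+1 by rewrite /k doubleS; lia.
rewrite k3 k2.
pose o1 := odd_part (re f); pose o2 := odd_part (im f).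
have term j : ((-1) ^+ j * deriv_delta j r f - deriv_delta j (- r) f) =
    o1^`(j) r +i* o2^`(j) r.
  rewrite /deriv_delta mulrA -exprMn mulrNN mulr1 expr1n mul1r.
  rewrite /o1 /o2 !odd_part_derive1n // /re /im.
  have -> : (-1) ^+ j = ((-1) ^+ j)%:C :> R[i] by rewrite rmorphXn rmorphN rmorph1.
  by apply/eqP; rewrite eq_complex /= !mul0r subr0 addr0 !eqxx.
under eq_bigr do rewrite term.
rewrite sum_complex.
have H (o : R -> R) : rsmooth o ->
    iter m walk (quot o) r = (\sum_(j < m.+1) beta_coef k j * r ^+ j * o^`(j) r) / r ^+ m.*2.+1.
  move=> so; rewrite iter_walk_quot // mulr_sumr mulr_suml; apply: eq_bigr => j _.
  have jm : (j <= m)%N by rewrite -ltnS.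
  rewrite beta_coefE //.
  have -> : r^-1 ^+ (m.*2.+1 - j) = r ^+ j / r ^+ m.*2.+1.
    rewrite exprVn; have jm2 : (j <= m.*2.+1)%N by lia.
    by rewrite -{2}(subnK jm2) exprD invfM mulrCA mulfV ?mulr1 // expf_neq0.
  by ring.
rewrite /walk_lift /radial -/r /profile -/o1 -/o2.
rewrite !H ?/o1 ?/o2; [|exact: rsmooth_odd_part..].
set A1 := \sum_(j < m.+1) _; set A2 := \sum_(j < m.+1) _.
rewrite -[_ * _ * _]mulrA mulrCA; congr (_ * _).
rewrite mulrCA [_^-1 * _]mulrC complex_div_real.
apply/eqP; rewrite eq_complex /=; apply/andP; split; apply/eqP; ring.
Qed.

(** On functions supported in a fixed compact set the weights in the Schwartz
    seminorms are bounded. *)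
Lemma seminorm_compact (B : R) n (vs : seq R) (f : R -> R[i]) : 0 <= B ->
  test_fun f -> (forall x, B < `|x| -> f x = 0) ->
  seminorm n vs f <= B ^+ n * seminorm 0 vs f.
Proof.
move=> B0 tf hf; have sf := test_schwartz tf.
have [/vsmooth_rsmooth s1 /vsmooth_rsmooth s2] := (smoothP f).1 tf.1.
apply: seminorm_le => x.
have [xB|xB] := leP `|x| B.
  apply: ler_pM; [exact: exprn_ge0|exact: normC_ge0| |].
    by apply: lerXn2r; rewrite // nnegrE.
  by have := seminorm_ub 0 vs sf x; rewrite expr0 mul1r.
have sn g j : supp_in B g -> supp_in B g^`(j).
  by move=> hg; elim: j => [//|j ih]; exact: supp_in_derive.
have z1 : (re f)^`(size vs) x = 0 by apply: sn xB => y hy; rewrite /re hf.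
have z2 : (im f)^`(size vs) x = 0 by apply: sn xB => y hy; rewrite /im hf.
rewrite iter_cderiveE !iter_deriveE // z1 z2 mulr0.
apply: (@le_trans _ _ 0); last by rewrite mulr_ge0 ?exprn_ge0 ?seminorm_ge0.
have := normC_le (0 +i* 0 : R[i]); rewrite /= normr0 addr0 => h.
by rewrite mulr_ge0_le0 ?exprn_ge0.
Qed.

Lemma distribution_of_extension (u T : (R -> R[i]) -> R[i]) :
  linear_on test_fun u -> schwartz_extension u T -> Defs.distribution u.
Proof.
move=> lu [[_ [C [L hC]]] ext]; split=> // K cK.
have [M [_ hM]] := compact_bounded cK; pose B := `|M| + 1.
have MB : M < B by rewrite /B; have := ler_norm M; lra.
have B0 : 0 <= B by rewrite /B addr_ge0.
pose W := \sum_(p <- L) B ^+ p.1.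
exists (`|C| * W), [seq p.2 | p <- L] => f tf hf; rewrite -(ext f tf).
have sf := test_schwartz tf.
have hB x : B < `|x| -> f x = 0.
  by move=> hx; apply: hf => Kx; have := hM _ MB x Kx; rewrite /= leNgt hx.
apply: (le_trans (hC f sf)).
apply: (@le_trans _ _ (`|C| * \sum_(p <- L) seminorm p.1 p.2 f)).
  by rewrite ler_wpM2r ?ler_norm // sumr_ge0 // => p _; exact: seminorm_ge0.
rewrite -mulrA ler_wpM2l // big_map mulr_sumr.
have WB p : p \in L -> B ^+ p.1 <= W.
  rewrite /W; elim: (L) => [//|q s ih]; rewrite in_cons big_cons.
  case/orP => [/eqP ->|/ih h].
    by rewrite lerDl sumr_ge0 // => q' _; rewrite exprn_ge0.
  by apply: (le_trans h); rewrite lerDr exprn_ge0.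
rewrite big_seq [leRHS]big_seq; apply: ler_sum => p pL.
apply: (le_trans (seminorm_compact p.1 p.2 B0 tf hB)).
by rewrite ler_wpM2r ?WB // seminorm_ge0.
Qed.

(** Carries the continuity of an extension T of mu over to T o lift. *)
Lemma lift_tame k (L : seq (nat * seq 'rV[R]_k)) : exists C (L' : seq (nat * seq R)),
  0 <= C /\ forall f, schwartz f ->
  \sum_(p <- L) seminorm p.1 p.2 (lift k f) <= C * \sum_(q <- L') seminorm q.1 q.2 f.
Proof.
elim: L => [|[m vs] L [C [L' [C0 hC]]]].
  by exists 0, [::]; split=> // f _; rewrite big_nil mul0r.
have [N [D [D0 hD]]] := lift_bound m vs.
exists (D + C), (seminorms_upto N ++ L'); split=> [|f sf]; first exact: addr_ge0.
have pos (s : seq (nat * seq R)) : 0 <= \sum_(q <- s) seminorm q.1 q.2 f.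
  by apply: sumr_ge0 => q _; exact: seminorm_ge0.
rewrite big_cons big_cat mulrDl; apply: lerD.
  apply: (le_trans (seminorm_le (hD f sf))).
  by rewrite ler_wpM2l // lerDl.
by apply: (le_trans (hC f sf)); rewrite ler_wpM2l // lerDr.
Qed.

End Sigma.

Theorem theorem2p3 (R : realType) (k : nat) (k_ge3 : (3 <= k)%N) (k_odd : odd k)
    (Lambda S : set 'rV[R]_k) (a b : 'rV[R]_k -> R[i])
    (Lambda_lf : locally_finite Lambda)
    (Lambda_supp : forall l, Lambda l -> a l != 0)
    (mu_temp : temperate (discrete_measure Lambda a))
    (S_lf : locally_finite S)
    (mu_hat : has_fourierk (discrete_measure Lambda a) (discrete_measure S b))
    (Lambda0 : ~ Lambda 0) (S0 : ~ S 0) :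
  temperate (sigma_measure Lambda a) /\
  has_fourier1 (sigma_measure Lambda a) (sigma_fourier S b).
Proof.
have [[mu_lin _] _] := mu_temp.
have [T [[[T_lin [C [L hC]]] T_ext] hatT]] := mu_hat.
have [D [L' [D0 hD]]] := lift_tame L.
pose Ts (f : R -> R[i]) := T (lift k f).
have Ts_ext : schwartz_extension (sigma_measure Lambda a) Ts.
  split; last first.
    by move=> f tf; rewrite sigma_lift // /Ts T_ext //; exact: lift_test.
  split.
    move=> c f g sf sg; rewrite /Ts lift_linear //.
    by apply: T_lin; exact: lift_schwartz.
  exists (`|C| * D), L' => f sf; apply: (le_trans (hC _ (lift_schwartz k sf))).
  rewrite -mulrA; apply: (@le_trans _ _
    (`|C| * \sum_(p <- L) seminorm p.1 p.2 (lift k f))).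
    rewrite ler_wpM2r ?ler_norm // sumr_ge0 // => p _.
    exact/seminorm_ge0/lift_schwartz.
  by rewrite ler_wpM2l //; exact: hD.
have sigma_lin : linear_on test_fun (sigma_measure Lambda a).
  move=> c f g tf tg; rewrite !sigma_lift // lift_linear; [|exact: test_schwartz..].
  by apply: mu_lin; exact: lift_test.
split.
  by split; [exact: distribution_of_extension Ts_ext|exists Ts].
exists Ts; split=> // f tf.
have [m km] : exists m, k = m.+1.*2.+1.
  exists k./2.-1; have := odd_double_half k; rewrite k_odd.
  by case: (k./2) => [|n] /=; lia.
subst k.
rewrite (sigma_fourier_walk_lift b S0 tf.1) hatT; last exact: walk_lift_test.
by rewrite fourier_lift.
Qed.
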